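(* Let $\delta_{\mathrm{in}}\in[1,2]$, $\delta_{\mathrm{out}} \in [0, 2\delta_{\mathrm{in}}]$, let $R$ be a ring, and let $\varepsilon > 0$ be a constant. There is a randomized algorithm for solving $(\delta_{\mathrm{in}}, \delta_{\mathrm{out}})$-$\mathsf{FSMM}_R$ on $n \times n$ matrices that performs $O(n^{\delta_{\mathrm{in}}+\varepsilon}+n^{\beta+\varepsilon})$ arithmetic operations over $R$, where \[ \beta := \max_{\eta_1, \eta_2 \in [0, 1],\ \eta_1 + \eta_2 = \delta_{\mathrm{out}}} \omega_{\delta_{\mathrm{in}}}(\eta_1,1,\eta_2). \]
   Context: For a ring $R$ and $\delta_{\mathrm{in}},\delta_{\mathrm{out}}\in[0,2]$, $(\delta_{\mathrm{in}},\delta_{\mathrm{out}})$-$\mathsf{FSMM}_R$ is: given $A,B\in R^{n\times n}$ with $\|A\|_0,\|B\|_0\le O(n^{\delta_{\mathrm{in}}})$ and with the promise $\|AB\|_0 \le O(n^{\delta_{\mathrm{out}}})$, compute $AB$. Here $\|M\|_0$ is the number of non-zero entries, and matrices are given in sparse representation (for each column, a list of (index, value) pairs of its non-zero entries). For $\alpha,\beta,\gamma\ge 0$ and $0\le\delta_{\mathrm{in}}\le\max\{\alpha+\beta,\beta+\gamma\}$, $\omega_{\delta_{\mathrm{in}}}(\alpha,\beta,\gamma)$ is the infimum over $\omega'\ge0$ such that the product of an $n^\alpha\times n^\beta$ matrix and an $n^\beta\times n^\gamma$ matrix, both with at most $O(n^{\delta_{\mathrm{in}}})$ non-zero entries, can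 be computed using $O(n^{\omega'})$ arithmetic operations. *)

(* Defs.v *)
From HB Require Import structures.
From mathcomp Require Import all_boot all_order all_algebra.
From mathcomp Require Import all_classical all_reals all_analysis.

Set Implicit Arguments.
Unset Strict Implicit.
Unset Printing Implicit Defensive.

Import Order.TTheory GRing.Theory Num.Theory.
Local Open Scope ring_scope.

(* Model of computation: algebraic complexity.  Ring elements live in an
   append-only sequence of registers, register k being the k-th item; the
   result of an instruction is appended.  Reading beyond the end gives 0.
   As in the usual complexity of straight-line programs over R, the constants
   of R are free and every addition, subtraction or multiplication costs 1. *)
Inductive instr (R : Type) : Type :=
| Const of R
| Add of nat & nat
| Sub of nat & nat
| Mul of nat & nat.

Definition exec_instr (R : pzRingType) (s : seq R) (c : instr R) : seq R :=
  rcons s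
    match c with
    | Const a => a
    | Add i j => s`_i + s`_j
    | Sub i j => s`_i - s`_j
    | Mul i j => s`_i * s`_j
    end.

Definition cost_instr (R : Type) (c : instr R) : nat :=
  if c is Const _ then 0%N else 1%N.

Definition straight_line (R : Type) : Type := seq (instr R).

Definition exec_straight_line (R : pzRingType) (s : seq R)
    (p : straight_line R) : seq R :=
  foldl (@exec_instr R) s p.

Definition cost_straight_line (R : Type) (p : straight_line R) : nat :=
  (\sum_(c <- p) cost_instr c)%N.

(* Algebraic computation trees: straight-line code with branching on whether a
   register is zero; such a test is charged as one operation.  A leaf carries
   the part of the output which is not made of ring elements. *)
Inductive ctree (R O : Type) : Type :=
| Leaf of O
| Step of instr R & ctree R O
| IfZero of nat & ctree R O & ctree R O.

Fixpoint exec_ctree (R : pzRingType) (O : Type) (t : ctree R O) (s : seq R) :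
    O * seq R :=
  match t with
  | Leaf o => (o, s)
  | Step c t' => exec_ctree t' (exec_instr s c)
  | IfZero i t0 t1 =>
      if s`_i == 0 then exec_ctree t0 s else exec_ctree t1 s
  end.

Fixpoint cost_ctree (R : pzRingType) (O : Type) (t : ctree R O) (s : seq R) :
    nat :=
  match t with
  | Leaf _ => 0%N
  | Step c t' => (cost_instr c + cost_ctree t' (exec_instr s c))%N
  | IfZero i t0 t1 =>
      (if s`_i == 0 then cost_ctree t0 s else cost_ctree t1 s).+1
  end.

Definition nnz (R : pzRingType) (m n : nat) (A : 'M[R]_(m, n)) : nat :=
  #|[set x : 'I_m * 'I_n | A x.1 x.2 != 0]|.

Definition sparse (V : Type) (m n : nat) : Type := n.-tuple (seq ('I_m * V)).

Definition sparse_repr (R : pzRingType) (m n : nat) (A : 'M[R]_(m, n)) :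
    sparse R m n :=
  [tuple [seq (i, A i j) | i <- enum 'I_m & A i j != 0] | j < n].

Definition sparse_indices (V : Type) (m n : nat) (s : sparse V m n) :
    n.-tuple (seq 'I_m) :=
  map_tuple (fun c => [seq x.1 | x <- c]) s.

Definition sparse_values (V : Type) (m n : nat) (s : sparse V m n) : seq V :=
  flatten [seq [seq x.2 | x <- c] | c <- s].

(* The order of the pairs inside a column of a sparse output is irrelevant. *)
Definition represents (R : pzRingType) (m n : nat) (s : sparse R m n)
    (A : 'M[R]_(m, n)) : bool :=
  [forall j : 'I_n, perm_eq (tnth s j) (tnth (sparse_repr A) j)].

(* A randomized algorithm multiplying two sparse n x n matrices: it draws a
   uniform string of random bits, reads the indices occurring in the sparse
   representations of the two matrices, and runs a computation tree whose
   initial registers are the listed values of the first matrix followed by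
   those of the second one.  Only operations on elements of R are charged.
   The output is a sparse matrix whose values are given as register numbers. *)
Record rand_mm_alg (R : Type) (n : nat) : Type := RandMMAlg {
  tape_len : nat;
  tree_of : tape_len.-tuple bool ->
            n.-tuple (seq 'I_n) -> n.-tuple (seq 'I_n) ->
            ctree R (sparse nat n n)
}.

Definition tree_for (R : pzRingType) (n : nat) (P : rand_mm_alg R n)
    (A B : 'M[R]_n) (rho : (tape_len P).-tuple bool) :
    ctree R (sparse nat n n) :=
  tree_of rho (sparse_indices (sparse_repr A)) (sparse_indices (sparse_repr B)).

Definition input_registers (R : pzRingType) (n : nat) (A B : 'M[R]_n) :
    seq R :=
  sparse_values (sparse_repr A) ++ sparse_values (sparse_repr B).

Definition alg_cost (R : pzRingType) (n : nat) (P : rand_mm_alg R n)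
    (A B : 'M[R]_n) (rho : (tape_len P).-tuple bool) : nat :=
  cost_ctree (tree_for A B rho) (input_registers A B).

Definition alg_output (R : pzRingType) (n : nat) (P : rand_mm_alg R n)
    (A B : 'M[R]_n) (rho : (tape_len P).-tuple bool) : sparse R n n :=
  let: (o, s) := exec_ctree (tree_for A B rho) (input_registers A B) in
  map_tuple (fun c => [seq (x.1, s`_(x.2)) | x <- c]) o.

Definition success_prob (K : realType) (R : pzRingType) (n : nat)
    (P : rand_mm_alg R n) (A B : 'M[R]_n) : K :=
  #|[set rho : (tape_len P).-tuple bool |
      represents (alg_output A B rho) (A *m B)]|%:R
    / #|{: (tape_len P).-tuple bool}|%:R.

(* The constants hidden in the hypotheses are quantified universally first:
   algorithm and bound may depend on them.  Randomized means Monte Carlo: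
   worst-case cost, and error probability at most 1/3 on every input. *)
Definition FSMM_solvable (K : realType) (R : pzRingType) (din dout : K)
    (f : nat -> K) : Prop :=
  forall C : K, exists (P : forall n : nat, rand_mm_alg R n) (C' : K),
    forall n : nat, (0 < n)%N -> forall A B : 'M[R]_n,
      (nnz A)%:R <= C * n%:R `^ din ->
      (nnz B)%:R <= C * n%:R `^ din ->
      (nnz (A *m B))%:R <= C * n%:R `^ dout ->
      (forall rho : (tape_len (P n)).-tuple bool,
         (alg_cost A B rho)%:R <= C' * f n) /\
      2%:R / 3%:R <= success_prob K (P n) A B.

Definition supported (R : pzRingType) (m n : nat) (S : {set 'I_m * 'I_n})
    (A : 'M[R]_(m, n)) : Prop :=
  forall i j, (i, j) \notin S -> A i j = 0.

Definition entries_on (R : Type) (m n : nat) (S : {set 'I_m * 'I_n})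
    (A : 'M[R]_(m, n)) : seq R :=
  [seq A x.1 x.2 | x <- enum S].

(* The straight-line program may depend on the positions S and T at which the
   two matrices are allowed to be nonzero, but not on the actual entries at
   these positions (which may vanish).  Its inputs are those entries; out
   tells in which register each entry of the product is found. *)
Definition computes_product (R : pzRingType) (m k n : nat)
    (S : {set 'I_m * 'I_k}) (T : {set 'I_k * 'I_n})
    (p : straight_line R) : Prop :=
  exists out : 'I_m -> 'I_n -> nat,
  forall (A : 'M[R]_(m, k)) (B : 'M[R]_(k, n)),
    supported S A -> supported T B ->
    forall i j,
      (exec_straight_line (entries_on S A ++ entries_on T B) p)`_(out i j)
      = (A *m B) i j.

Definition dim_pow (K : realType) (n : nat) (a : K) : nat :=
  Num.truncn (n%:R `^ a).

Definition sparse_mm_exponent (K : realType) (R : pzRingType)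
    (d a b c w : K) : Prop :=
  forall C : K, exists C' : K, forall n : nat, (0 < n)%N ->
    forall (S : {set 'I_(dim_pow n a) * 'I_(dim_pow n b)})
           (T : {set 'I_(dim_pow n b) * 'I_(dim_pow n c)}),
      #|S|%:R <= C * n%:R `^ d ->
      #|T|%:R <= C * n%:R `^ d ->
      exists2 p : straight_line R,
        computes_product S T p
        & (cost_straight_line p)%:R <= C' * n%:R `^ w.

(* Also used when d > max (a + b) (b + c), where the sparsity condition is
   void for large n. *)
Definition omega (K : realType) (R : pzRingType) (d a b c : K) : K :=
  inf [set w : K | 0 <= w /\ sparse_mm_exponent R d a b c w]%classic.

Definition is_max (K : realType) (E : set K) (x : K) : Prop :=
  E x /\ forall y : K, E y -> y <= x.

Definition omega_values (K : realType) (R : pzRingType) (din dout : K) :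
    set K :=
  [set w : K | exists eta1 eta2 : K,
     [/\ 0 <= eta1 <= 1, 0 <= eta2 <= 1, eta1 + eta2 = dout
       & w = omega R din eta1 1 eta2]]%classic.

(* Main.v *)
Require Import Defs.
From mathcomp Require Import all_boot all_order all_algebra.
From mathcomp Require Import all_classical all_reals all_analysis.
From mathcomp Require Import ring lra zify.

(* A column of A B with at most 2^k / 2 non-zero entries is recovered by hashing
   the rows into 2^k buckets, which amounts to multiplying a (2^k x n) matrix
   H A by B, where H A is not denser than A: with probability 1/2 a given row i
   is alone in its bucket, and then the bucket contains the entry of A B in row
   i.  That i is alone is tested by summing random parts of the rest of the
   bucket.  Increasing k and keeping only the columns J which are not yet
   recovered, one has 2^k |J| <= 4 ||A B||_0, so that all the products have
   outer dimensions n^(e1 + o(1)) and n^(e2 + o(1)) with e1 + e2 = dout and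
   their cost is governed by omega(e1, 1, e2).

   Cutting matrices into blocks shows that omega(e1, 1, dout - e1) is Lipschitz
   in e1, hence the maximum beta is attained and finitely many values of e1 are
   enough.  The zero tests, n^(dout + o(1)) of them, are paid for by
   beta >= dout, which holds because the entries of an outer product all have to
   be computed separately. *)

Set Implicit Arguments.
Unset Strict Implicit.
Unset Printing Implicit Defensive.

Import Order.TTheory GRing.Theory Num.Theory.
Local Open Scope ring_scope.

(** * Straight-line programs *)

(** A leaf of a computation tree fixes the positions of the output, and the columns recovered at one
    level determine the dimensions of the next product. A level therefore carries out all its zero
    tests before anything is decided: on the inputs that share the outcomes every decision is the
    same, and it can be read off from one representative.

    The same random bits serve all levels, although the set [J] depends on them. This is harmless,
    because good randomness is a property of the product [A B] for all levels, rows and columns,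
    without reference to [J], so that a union bound applies. With bad randomness too many columns
    may remain; the tree then stops with an arbitrary output, which keeps the cost bound valid for
    every seed.

    Hashing and testing use only sums of entries: a random part of a bucket that hides a nonzero
    entry has sum 0 with probability at most 1/2 in any ring, with no need for random coefficients.
    Level 0 escapes the bound on [2 ^ k * #|J|], as nothing is known about the columns yet; it is a
    product with a single row, which the term [n ^ din] pays for. *)

Section StraightLine.
Variable R : pzRingType.
Implicit Types (s : seq R) (p : straight_line R) (c : instr R).

Lemma size_exec_instr s c : size (exec_instr s c) = (size s).+1.
Proof. by rewrite size_rcons. Qed.

Lemma nth_exec_instr s c i : (i < size s)%N -> (exec_instr s c)`_i = s`_i.
Proof. by move=> lti; rewrite nth_rcons lti. Qed.

Lemma exec_straight_line_rcons s p c :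
  exec_straight_line s (rcons p c) = exec_instr (exec_straight_line s p) c.
Proof. by rewrite /exec_straight_line foldl_rcons. Qed.

Lemma exec_straight_line_cat s p q :
  exec_straight_line s (p ++ q) =
  exec_straight_line (exec_straight_line s p) q.
Proof. by rewrite /exec_straight_line foldl_cat. Qed.

Lemma cost_straight_line_cat p q :
  cost_straight_line (p ++ q) = (cost_straight_line p + cost_straight_line q)%N.
Proof. by rewrite /cost_straight_line big_cat. Qed.

Lemma size_exec_straight_line s p :
  size (exec_straight_line s p) = (size s + size p)%N.
Proof.
elim/last_ind: p => [|p c IH]; first by rewrite addn0.
by rewrite exec_straight_line_rcons size_exec_instr IH size_rcons addnS.
Qed.

Lemma nth_exec_straight_line s p i :
  (i < size s)%N -> (exec_straight_line s p)`_i = s`_i.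
Proof.
move=> lti; elim/last_ind: p => [|p c IH] //.
rewrite exec_straight_line_rcons nth_exec_instr ?IH //.
by rewrite size_exec_straight_line ltn_addr.
Qed.

Definition map_instr (g : nat -> nat) c : instr R :=
  match c with
  | Const a => Const a
  | Add i j => Add R (g i) (g j)
  | Defs.Sub i j => Defs.Sub R (g i) (g j)
  | Mul i j => Mul R (g i) (g j)
  end.

Definition eval_instr s c : R :=
  match c with
  | Const a => a
  | Add i j => s`_i + s`_j
  | Defs.Sub i j => s`_i - s`_j
  | Mul i j => s`_i * s`_j
  end.

Lemma exec_instrE s c : exec_instr s c = rcons s (eval_instr s c).
Proof. by []. Qed.

Lemma eval_map_instr (g : nat -> nat) s s0 c :
  (forall i, s`_(g i) = s0`_i) -> eval_instr s (map_instr g c) = eval_instr s0 c.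
Proof. by case: c => //= i j Hg; rewrite !Hg. Qed.

Lemma cost_map_instr (g : nat -> nat) p :
  cost_straight_line (map (map_instr g) p) = cost_straight_line p.
Proof.
by rewrite /cost_straight_line big_map; apply: eq_bigr => -[].
Qed.

(* Registers beyond the inputs keep their offset, so that reading beyond the
   end still gives 0. *)
Definition relocate (m k : nat) (g : nat -> nat) (i : nat) : nat :=
  if (i < m)%N then g i else (i - m + k)%N.

Lemma exec_relocate s s0 (g : nat -> nat) p :
    (forall i, (i < size s0)%N -> (g i < size s)%N /\ s`_(g i) = s0`_i) ->
  forall i,
    (exec_straight_line s (map (map_instr (relocate (size s0) (size s) g)) p))
      `_(relocate (size s0) (size s) g i) = (exec_straight_line s0 p)`_i.
Proof.
move=> Hg; elim/last_ind: p => [|p c IH] i.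
  rewrite /= /relocate; case: ltnP => [/Hg[] //|lei].
  by rewrite !nth_default // leq_addl.
rewrite map_rcons !exec_straight_line_rcons !exec_instrE !nth_rcons.
rewrite !size_exec_straight_line size_map (eval_map_instr _ IH).
case: (ltnP i (size s0)) => [lti|lei].
  have [ltg _] := Hg i lti.
  rewrite [in (relocate _ _ _ _ < _)%N]/relocate lti (leq_trans ltg) ?leq_addr //.
  by rewrite ltn_addr.
have -> : (relocate (size s0) (size s) g i < size s + size p)%N =
          (i < size s0 + size p)%N.
  by rewrite /relocate (ltnNge i (size s0)) lei /= addnC ltn_add2l ltn_subLR.
have -> : (relocate (size s0) (size s) g i == size s + size p)%N =
          (i == size s0 + size p)%N.
  rewrite /relocate (ltnNge i (size s0)) lei /= addnC eqn_add2l.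
  by rewrite -(eqn_add2l (size s0)) subnKC.
by rewrite IH.
Qed.

End StraightLine.

(** * Computations uniform in a parameter [x : X] *)

Section Computable.
Variables (R : pzRingType) (X : Type).
Implicit Types (s : seq (X -> R)) (f : X -> R) (P Q : set (X -> R)).

Definition regs s (x : X) : seq R := [seq f x | f <- s].

Definition held s f : Prop :=
  exists2 i, (i < size s)%N & forall x, (regs s x)`_i = f x.

(** Registers are functions on a space [X] of inputs, and one program has to serve all of [X].
    Quantifying over every state [s] that holds [P], in whatever registers, is what lets such
    computations be chained. *)
Definition computable (c : nat) P Q : Prop :=
  forall s, (forall f, P f -> held s f) ->
  exists s' (p : straight_line R),
    [/\ (cost_straight_line p <= c)%N,
        forall x, exec_straight_line (regs s x) p = regs (s ++ s') x
      & forall f, Q f -> held (s ++ s') f].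

Lemma size_regs s x : size (regs s x) = size s.
Proof. exact: size_map. Qed.

Lemma held_cat s s' f : held s f -> held (s ++ s') f.
Proof.
case=> i lti Hi; exists i; first by rewrite size_cat ltn_addr.
by move=> x; rewrite /regs map_cat nth_cat size_map lti Hi.
Qed.

Lemma held_mem s f : (exists i, (i < size s)%N /\ nth f s i = f) -> held s f.
Proof.
case=> i [lti Hi]; exists i => // x.
by rewrite /regs (nth_map f) // Hi.
Qed.

Lemma exec_regs s (p : straight_line R) :
  exists s', size s' = size p /\
    forall x, exec_straight_line (regs s x) p = regs (s ++ s') x.
Proof.
elim/last_ind: p => [|p c [s' [szs' Hs']]].
  by exists [::]; split=> // x; rewrite cats0.
exists (rcons s' (fun x => last 0 (exec_instr (regs (s ++ s') x) c))).
split; first by rewrite !size_rcons szs'.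
move=> x; rewrite exec_straight_line_rcons Hs' -rcons_cat /regs map_rcons.
by rewrite last_rcons.
Qed.

Lemma computableI (c : nat) P Q :
  (forall s, (forall f, P f -> held s f) ->
   exists2 p : straight_line R, (cost_straight_line p <= c)%N
   & forall f, Q f -> exists2 i, (i < size s + size p)%N
       & forall x, (exec_straight_line (regs s x) p)`_i = f x) ->
  computable c P Q.
Proof.
move=> H s Ps; have [p cp Hp] := H s Ps; have [s' [szs' Hs']] := exec_regs s p.
exists s', p; split=> // f /Hp[i lti Hi]; exists i; first by rewrite size_cat szs'.
by move=> x; rewrite -Hs'.
Qed.

Lemma computable_sub c c' P P' Q Q' :
  computable c P Q -> (c <= c')%N -> (P `<=` P')%classic ->
  (Q' `<=` Q)%classic -> computable c' P' Q'.
Proof.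
move=> H lec PP' QQ' s Ps.
have [|s' [p [cp Hp Hq]]] := H s; first by move=> f /PP'; apply: Ps.
by exists s', p; split=> // [|f /QQ' /Hq]; rewrite ?(leq_trans cp).
Qed.

Lemma computable_refl P : computable 0 P P.
Proof.
move=> s Ps; exists [::], [::]; split=> // [|x|f /Ps].
- by rewrite /cost_straight_line big_nil.
- by rewrite cats0.
- by rewrite cats0.
Qed.

Lemma computable_trans c c' P Q Q' :
  computable c P Q -> computable c' (P `|` Q)%classic Q' ->
  computable (c + c') P (Q `|` Q')%classic.
Proof.
move=> H H' s Ps; have [s1 [p1 [c1 E1 H1]]] := H s Ps.
have [|s2 [p2 [c2 E2 H2]]] := H' (s ++ s1).
  by move=> f [/Ps|/H1//]; apply: held_cat.
exists (s1 ++ s2), (p1 ++ p2); split.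
- by rewrite cost_straight_line_cat leq_add.
- by move=> x; rewrite exec_straight_line_cat E1 E2 catA.
- by move=> f; rewrite catA => -[/H1|/H2//]; apply: held_cat.
Qed.

Lemma computableU c c' P Q Q' :
  computable c P Q -> computable c' P Q' ->
  computable (c + c') P (Q `|` Q')%classic.
Proof.
move=> H H'; apply: computable_trans H _.
by apply: (computable_sub H') => // f; left.
Qed.

Lemma computable_big (I : eqType) (r : seq I) (c : I -> nat) P
    (Q : I -> set (X -> R)) :
  (forall i, i \in r -> computable (c i) P (Q i)) ->
  computable (\sum_(i <- r) c i) P
    [set f | exists2 i, i \in r & Q i f]%classic.
Proof.
elim: r => [|i r IH] H.
  rewrite big_nil; apply: (computable_sub (@computable_refl P)) => //.
  by move=> f [].
rewrite big_cons.
have HU := computableU (H i (mem_head _ _))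
  (IH (fun j jr => H j (mem_behead (s := i :: r) jr))).
apply: (computable_sub HU) => // f [j]; rewrite inE => /predU1P[->|jr] Qf.
  by left.
by right; exists j.
Qed.

Lemma computable_const a P : computable 0 P [set (fun=> a)]%classic.
Proof.
apply: computableI => s _; exists [:: Const a].
  by rewrite /cost_straight_line big_seq1.
move=> f ->; exists (size s); first by rewrite addn1.
by move=> x; rewrite /= nth_rcons size_regs ltnn eqxx.
Qed.

Lemma computable_add P f g : P f -> P g ->
  computable 1 P [set (fun x => f x + g x)]%classic.
Proof.
move=> Pf Pg; apply: computableI => s Ps.
have [[i lti Hi] [j ltj Hj]] := (Ps _ Pf, Ps _ Pg).
exists [:: Add R i j]; first by rewrite /cost_straight_line big_seq1.
move=> _ ->; exists (size s); first by rewrite addn1.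
by move=> x; rewrite /= nth_rcons size_regs ltnn eqxx Hi Hj.
Qed.

Lemma computable_mul P f g : P f -> P g ->
  computable 1 P [set (fun x => f x * g x)]%classic.
Proof.
move=> Pf Pg; apply: computableI => s Ps.
have [[i lti Hi] [j ltj Hj]] := (Ps _ Pf, Ps _ Pg).
exists [:: Mul R i j]; first by rewrite /cost_straight_line big_seq1.
move=> _ ->; exists (size s); first by rewrite addn1.
by move=> x; rewrite /= nth_rcons size_regs ltnn eqxx Hi Hj.
Qed.

Lemma computable_sum (I : eqType) (r : seq I) (F : I -> X -> R) P :
  (forall i, i \in r -> P (F i)) ->
  computable (size r) P [set (fun x => \sum_(i <- r) F i x)]%classic.
Proof.
elim: r => [|i r IH] H.
  apply: (computable_sub (@computable_const 0 P)) => // _ ->.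
  by apply: funext => x; rewrite big_nil.
have Hr : forall j, j \in r -> P (F j).
  by move=> j jr; apply: H; rewrite inE jr orbT.
have Ht := computable_trans (IH Hr) (computable_add
  (P := (P `|` [set (fun x => \sum_(i <- r) F i x)])%classic)
  (or_introl (H i (mem_head i r)))
  (or_intror (erefl : [set (fun x => \sum_(i <- r) F i x)]%classic _))).
apply: (computable_sub Ht) => // [|_ ->]; first by rewrite addn1.
right; apply: funext => x; by rewrite big_cons.
Qed.

Lemma computable_dot (I : eqType) (r : seq I) (F G : I -> X -> R) P :
  (forall i, i \in r -> P (F i)) -> (forall i, i \in r -> P (G i)) ->
  computable (2 * size r) P [set (fun x => \sum_(i <- r) F i x * G i x)]%classic.
Proof.
move=> HF HG.
have H1 := computable_big (fun i ir => computable_mul (HF i ir) (HG i ir)).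
have H2 := computable_trans H1 (@computable_sum _ r (fun i x => F i x * G i x) _
  (fun i ir => or_intror (ex_intro2 _ _ i ir erefl))).
apply: (computable_sub H2) => //.
by rewrite sum1_size mul2n addnn.
Qed.

End Computable.

(** * Products of sparse matrices *)

Section MatrixProduct.
Variable R : pzRingType.

Definition entries_in (X : Type) (m n : nat) (S : {set 'I_m * 'I_n})
    (A : X -> 'M[R]_(m, n)) : set (X -> R) :=
  [set f | exists2 e, e \in S & f = (fun x => A x e.1 e.2)]%classic.

Definition all_entries (X : Type) (m n : nat) (A : X -> 'M[R]_(m, n)) :
    set (X -> R) :=
  [set f | exists i j, f = (fun x => A x i j)]%classic.

(** The matrices may be any functions of [x], so that a product can be applied to matrices computed
    earlier, such as hashed ones, independently of the layout of the registers. *)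
Definition mm_within (c m k n : nat) (S : {set 'I_m * 'I_k})
    (T : {set 'I_k * 'I_n}) : Prop :=
  forall (X : Type) (A : X -> 'M[R]_(m, k)) (B : X -> 'M[R]_(k, n)),
    (forall x, supported S (A x)) -> (forall x, supported T (B x)) ->
    computable c (entries_in S A `|` entries_in T B)%classic
      (all_entries (fun x => A x *m B x)).

Lemma mm_within_leq c c' m k n (S : {set 'I_m * 'I_k}) (T : {set 'I_k * 'I_n}) :
  (c <= c')%N -> mm_within c S T -> mm_within c' S T.
Proof.
by move=> lec H X A B HA HB; apply: (computable_sub (H X A B HA HB)).
Qed.

Lemma size_entries_on m n (S : {set 'I_m * 'I_n}) (A : 'M[R]_(m, n)) :
  size (entries_on S A) = #|S|.
Proof. by rewrite size_map -cardE. Qed.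

Lemma computes_product_mm_within m k n (S : {set 'I_m * 'I_k})
    (T : {set 'I_k * 'I_n}) (p : straight_line R) :
  computes_product S T p -> mm_within (cost_straight_line p) S T.
Proof.
case=> out Hout X A B HA HB; apply: computableI => s Hs.
pose s0 x := entries_on S (A x) ++ entries_on T (B x).
have szs0 x : size (s0 x) = (#|S| + #|T|)%N.
  by rewrite size_cat !size_entries_on.
have /choice[g Hg] : forall i, exists gi, (i < #|S| + #|T|)%N ->
    (gi < size s)%N /\ forall x, (regs s x)`_gi = (s0 x)`_i.
  move=> i; case: (ltnP i (#|S| + #|T|)) => [lti|_]; last by exists 0%N.
  case: (ltnP i #|S|) => [ltS|leS].
    have /card_gt0P[e0 _] := leq_ltn_trans (leq0n i) ltS.
    rewrite cardE in ltS.
    have [|gi gi1 gi2] := Hs (fun x => A x (nth e0 (enum S) i).1 (nth e0 (enum S) i).2).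
      by left; exists (nth e0 (enum S) i); rewrite // -mem_enum mem_nth.
    exists gi => _; split=> // x; rewrite gi2 /s0 nth_cat size_entries_on.
    by rewrite cardE ltS /entries_on (nth_map e0).
  have ltT : (i - #|S| < #|T|)%N by rewrite ltn_subLR.
  have /card_gt0P[e0 _] := leq_ltn_trans (leq0n _) ltT.
  rewrite [in X in (_ < X)%N]cardE in ltT.
  have [|gi gi1 gi2] := Hs (fun x => B x (nth e0 (enum T) (i - #|S|)).1
                                         (nth e0 (enum T) (i - #|S|)).2).
    by right; exists (nth e0 (enum T) (i - #|S|)); rewrite // -mem_enum mem_nth.
  exists gi => _; split=> // x; rewrite gi2 /s0 nth_cat size_entries_on.
  by rewrite ltnNge leS /= /entries_on (nth_map e0).
(* [held] asks for an existing register, whereas [out] may point beyond the end of the run, where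
   reading gives 0. A free [Const 0] in front supplies a register for that case; it shifts the
   offset by one, whence [(size s).+1]. *)
pose h := relocate (#|S| + #|T|) (size s).+1 g.
exists (Const 0 :: map (map_instr h) p).
  by rewrite /cost_straight_line big_cons -/(cost_straight_line _) cost_map_instr.
have Hrun x i : (exec_straight_line (regs s x)
    (Const 0 :: map (map_instr h) p))`_(h i) =
    (exec_straight_line (s0 x) p)`_i.
  have := @exec_relocate R (rcons (regs s x) 0) (s0 x) g p _ i.
  rewrite szs0 size_rcons size_regs; apply => {}i lti; have [ltg Hi] := Hg i lti.
  by rewrite ltnS ltnW // nth_rcons size_regs ltg Hi.
move=> _ [i [j ->]].
case: (ltnP (out i j) (#|S| + #|T| + size p)) => Hij.
  exists (h (out i j)); last by move=> x; rewrite Hrun Hout.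
  rewrite /= size_map /h /relocate; case: (ltnP (out i j) (#|S| + #|T|)) => [lto|leo].
    by have [ltg _] := Hg _ lto; rewrite ltn_addr.
  by rewrite !addnS addnC ltnS ltn_add2l ltn_subLR.
exists (size s); first by rewrite /= size_map addnS ltnS leq_addr.
move=> x; rewrite -Hout // [RHS]nth_default.
  rewrite /exec_straight_line [foldl _ _ _]/= -/(exec_straight_line _ _).
  rewrite nth_exec_straight_line ?size_rcons ?size_regs //.
  by rewrite nth_rcons size_regs ltnn eqxx.
by rewrite size_exec_straight_line szs0.
Qed.

(** Taking for [X] the space of all supported pairs turns the registers into generic entries, so
    that the program obtained works for each pair. *)
Lemma mm_within_computes_product c m k n (S : {set 'I_m * 'I_k})
    (T : {set 'I_k * 'I_n}) : mm_within c S T ->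
  exists2 p : straight_line R,
    computes_product S T p & (cost_straight_line p <= c)%N.
Proof.
pose X := {AB : 'M[R]_(m, k) * 'M[R]_(k, n) | supported S AB.1 /\ supported T AB.2}.
move=> /(_ X (fun x => (sval x).1) (fun x => (sval x).2)) H.
pose s : seq (X -> R) := [seq (fun x : X => (sval x).1 e.1 e.2) | e <- enum S] ++
  [seq (fun x : X => (sval x).2 e.1 e.2) | e <- enum T].
have regsE x : regs s x = entries_on S (sval x).1 ++ entries_on T (sval x).2.
  by rewrite /regs map_cat -!map_comp.
have := H (fun x => (svalP x).1) (fun x => (svalP x).2) s.
case=> [f [] [e eS ->]|s' [p [cp Hp Hf]]].
- apply: held_cat; apply: held_mem; exists (index e (enum S)).
  rewrite size_map index_mem mem_enum; split=> //.
  by rewrite (nth_map e) ?index_mem ?mem_enum // nth_index ?mem_enum.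
- apply: held_mem; exists (#|S| + index e (enum T))%N.
  rewrite size_cat !size_map -cardE ltn_add2l index_mem mem_enum; split=> //.
  rewrite nth_cat size_map -cardE ltnNge leq_addr addKn /=.
  by rewrite (nth_map e) ?index_mem ?mem_enum // nth_index ?mem_enum.
exists p => //.
have /choice[out Hout] : forall ij : 'I_m * 'I_n, exists r, forall x,
    (exec_straight_line (regs s x) p)`_r = ((sval x).1 *m (sval x).2) ij.1 ij.2.
  move=> [i j]; have [r _ Hr] := Hf _ (ex_intro _ i (ex_intro _ j erefl)).
  by exists r => x; rewrite Hp Hr.
exists (fun i j => out (i, j)) => A B HA HB i j.
have := Hout (i, j) (exist _ (A, B) (conj HA HB) : X).
by rewrite regsE.
Qed.

(** For each of the [m] rows, a position of [T] costs at most one multiplication and one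
    addition. *)
Lemma mm_within_naive m k n (S : {set 'I_m * 'I_k}) (T : {set 'I_k * 'I_n}) :
  mm_within (m * (2 * #|T|)) S T.
Proof.
move=> X A B HA HB.
pose r i j := [seq l <- enum 'I_k | ((i, l) \in S) && ((l, j) \in T)].
have H i j := @computable_dot R X _ (r i j) (fun l x => A x i l)
  (fun l x => B x l j) (entries_in S A `|` entries_in T B)%classic.
have {}H (ij : 'I_m * 'I_n) : ij \in enum {: 'I_m * 'I_n} ->
   computable (2 * size (r ij.1 ij.2))
  (entries_in S A `|` entries_in T B)%classic
  [set (fun x => (A x *m B x) ij.1 ij.2)]%classic.
  move=> _; case: ij => i j /=.
  have {H} := H i j; have E : (fun x => \sum_(l <- r i j) A x i l * B x l j) =
    (fun x => (A x *m B x) i j).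
    apply: funext => x; rewrite mxE big_filter big_enum_cond /=.
    rewrite [RHS](bigID (fun l => ((i, l) \in S) && ((l, j) \in T))) /=.
    rewrite [X in _ = _ + X]big1 ?addr0 // => l; rewrite negb_and.
    by case/orP => [/HA->|/HB->]; rewrite ?mul0r ?mulr0.
  rewrite E; apply => l; rewrite mem_filter => /andP[/andP[lS lT] _].
    by left; exists (i, l).
  by right; exists (l, j).
apply: (computable_sub (computable_big H)) => //; last first.
  by move=> _ [i [j ->]]; exists (i, j); rewrite ?mem_enum.
rewrite big_enum /= -(pair_bigA _ (fun i j => 2 * size (r i j))%N) /=.
rewrite -[X in (_ <= X * _)%N]card_ord -sum_nat_const leq_sum // => i _.
rewrite -big_distrr leq_mul2l /=.
have -> : #|T| = (\sum_j \sum_(l | (l, j) \in T) 1)%N.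
  rewrite -sum1_card pair_big_dep /=.
  rewrite (reindex (fun p : 'I_n * 'I_k => (p.2, p.1))) /=.
    by apply: eq_bigl => -[].
  by exists (fun p => (p.2, p.1)) => -[].
apply: leq_sum => j _; rewrite -sum1_size big_filter big_enum_cond /=.
rewrite big_mkcond [X in (_ <= X)%N]big_mkcond /= leq_sum // => l _.
by case: (_ \in T); rewrite ?andbT ?andbF //; case: (_ \in S).
Qed.

(** A value [None] of [r] or [q] stands for a zero row or column, so that an incomplete block can be
    padded. Padding is free, because only the entries in the supports are inputs. *)
Lemma mm_within_piece c m k n m0 n0 (S : {set 'I_m * 'I_k})
    (T : {set 'I_k * 'I_n}) (r : 'I_m0 -> option 'I_m)
    (q : 'I_n0 -> option 'I_n) X (A : X -> 'M[R]_(m, k))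
    (B : X -> 'M[R]_(k, n)) :
  (forall x, supported S (A x)) -> (forall x, supported T (B x)) ->
  mm_within c [set e | if r e.1 is Some i then (i, e.2) \in S else false]
              [set e | if q e.2 is Some j then (e.1, j) \in T else false] ->
  computable c (entries_in S A `|` entries_in T B)%classic
    [set f | exists i0 i j0 j, [/\ r i0 = Some i, q j0 = Some j
      & f = (fun x => (A x *m B x) i j)]]%classic.
Proof.
move=> HA HB /(_ X
  (fun x => \matrix_(i, l) if r i is Some i' then A x i' l else 0)
  (fun x => \matrix_(l, j) if q j is Some j' then B x l j' else 0)) H.
apply: (computable_sub (H _ _)) => //.
- move=> x i j; rewrite !inE mxE /=; case: (r i) => // i'; exact: HA.
- move=> x i j; rewrite !inE mxE /=; case: (q j) => // j'; exact: HB.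
- move=> f [] [[i j]]; rewrite inE /=.
    case E: (r i) => [i'|//] iS ->; left; exists (i', j) => //=.
    by apply: funext => x; rewrite mxE E.
  case E: (q j) => [j'|//] iS ->; right; exists (i, j') => //=.
  by apply: funext => x; rewrite mxE E.
- move=> f [i0 [i [j0 [j [ri qj ->]]]]]; exists i0, j0.
  apply: funext => x; rewrite !mxE; apply: eq_bigr => l _.
  by rewrite !mxE ri qj.
Qed.

Lemma card_piece_rows m k m0 (S : {set 'I_m * 'I_k}) (r : 'I_m0 -> option 'I_m) :
  (forall i i' j, r i = Some j -> r i' = Some j -> i = i') ->
  (#|[set e : 'I_m0 * 'I_k | if r e.1 is Some i then (i, e.2) \in S else false]|
     <= #|S|)%N.
Proof.
move=> rI; pose f (e : 'I_m0 * 'I_k) := omap (fun i => (i, e.2)) (r e.1).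
rewrite -(card_imset (mem S) (@Some_inj _)) -(@card_in_imset _ _ f); last first.
  move=> [i l] [i' l']; rewrite !inE /f /=.
  case E: (r i) => [a|//] _; case E': (r i') => [a'|//] _ [eqa eql].
  by rewrite eql (rI i i' a) // eqa.
apply/subset_leq_card/fintype.subsetP => _ /imsetP[[i l] + ->]; rewrite inE /f /=.
by case: (r i) => //= a aS; apply: imset_f.
Qed.

Lemma card_piece_cols m k m0 (S : {set 'I_k * 'I_m}) (r : 'I_m0 -> option 'I_m) :
  (forall i i' j, r i = Some j -> r i' = Some j -> i = i') ->
  (#|[set e : 'I_k * 'I_m0 | if r e.2 is Some i then (e.1, i) \in S else false]|
     <= #|S|)%N.
Proof.
move=> rI; pose f (e : 'I_k * 'I_m0) := omap (fun i => (e.1, i)) (r e.2).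
rewrite -(card_imset (mem S) (@Some_inj _)) -(@card_in_imset _ _ f); last first.
  move=> [l i] [l' i']; rewrite !inE /f /=.
  case E: (r i) => [a|//] _; case E': (r i') => [a'|//] _ [eql eqa].
  by rewrite eql (rI i i' a) // eqa.
apply/subset_leq_card/fintype.subsetP => _ /imsetP[[l i] + ->]; rewrite inE /f /=.
by case: (r i) => //= a aS; apply: imset_f.
Qed.

(** Only the outer dimensions are cut, so each entry of the product comes from a single pair of
    blocks and no partial results have to be added. *)
Lemma mm_within_blocks c m k n m0 n0 pm pn (S : {set 'I_m * 'I_k})
    (T : {set 'I_k * 'I_n}) : (m <= pm * m0)%N -> (n <= pn * n0)%N ->
  (forall (S0 : {set 'I_m0 * 'I_k}) (T0 : {set 'I_k * 'I_n0}),
     (#|S0| <= #|S|)%N -> (#|T0| <= #|T|)%N -> mm_within c S0 T0) ->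
  mm_within (pm * pn * c) S T.
Proof.
move=> lem len H X A B HA HB.
have block_inj d d0 b : forall (i i' : 'I_d0) (j : 'I_d),
    insub (b * d0 + i)%N = Some j -> insub (b * d0 + i')%N = Some j -> i = i'.
  move=> i i' j; case: insubP => //= u _ Hu [eu]; case: insubP => //= u' _ Hu' [eu'].
  by apply: val_inj; apply/eqP; rewrite -(eqn_add2l (b * d0)) -Hu -Hu' eu eu'.
have block_ex d d0 pd (i : 'I_d) : (d <= pd * d0)%N ->
    exists (b : 'I_pd) (i0 : 'I_d0), insub (b * d0 + i0)%N = Some i.
  move=> led; have lti := leq_trans (ltn_ord i) led.
  have d0_gt0 : (0 < d0)%N by case: d0 lti {led} => //; rewrite muln0.
  have ltq : (i %/ d0 < pd)%N by rewrite ltn_divLR.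
  exists (Ordinal ltq), (Ordinal (ltn_pmod i d0_gt0)); rewrite /= -divn_eq.
  by rewrite insubT //= => lt; congr Some; apply: val_inj.
pose rb d d0 (b : nat) (i : 'I_d0) : option 'I_d := insub (b * d0 + i)%N.
have HP (b : 'I_pm * 'I_pn) : b \in enum {: 'I_pm * 'I_pn} ->
    computable c (entries_in S A `|` entries_in T B)%classic
    [set f | exists i0 i j0 j, [/\ rb m m0 b.1 i0 = Some i, rb n n0 b.2 j0 = Some j
      & f = (fun x => (A x *m B x) i j)]]%classic.
  move=> _; apply: mm_within_piece => //; apply: H.
    apply: card_piece_rows; exact: block_inj.
  apply: card_piece_cols; exact: block_inj.
apply: (computable_sub (computable_big HP)) => //.
  by rewrite big_enum sum_nat_const card_prod !card_ord.
move=> _ [i [j ->]].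
have [bi [i0 Hi]] := block_ex _ _ _ i lem; have [bj [j0 Hj]] := block_ex _ _ _ j len.
by exists (bi, bj); [rewrite mem_enum | exists i0, i, j0, j].
Qed.

Lemma nth_exec_const (s : seq R) (p : straight_line R) t a :
  (t < size p)%N -> nth (Const 0) p t = Const a ->
  (exec_straight_line s p)`_(size s + t) = a.
Proof.
move=> ltt Et; rewrite -(cat_take_drop t p) (drop_nth (Const 0) ltt) Et.
rewrite -cat_rcons exec_straight_line_cat nth_exec_straight_line; last first.
  by rewrite size_exec_straight_line size_rcons size_takel ?(ltnW ltt) // addnS.
rewrite exec_straight_line_rcons /exec_instr nth_rcons.
by rewrite size_exec_straight_line size_takel ?(ltnW ltt) // ltnn eqxx.
Qed.

(* The m n entries of an outer product are distinct functions of the input,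
   none of which is constant or equal to an input. *)
Lemma outer_product_cost m k n (l : 'I_k) (p : straight_line R) :
  (1 : R) != 0 ->
  computes_product [set e : 'I_m * 'I_k | e.2 == l]
                   [set e : 'I_k * 'I_n | e.1 == l] p ->
  (m * n <= cost_straight_line p)%N.
Proof.
move=> R1; set S := [set _ | _]; set T := [set _ | _] => -[out Hout].
pose dA (i : 'I_m) : 'M[R]_(m, k) := delta_mx i l.
pose dB (j : 'I_n) : 'M[R]_(k, n) := delta_mx l j.
have SdA i : supported S (dA i).
  by move=> i' l'; rewrite inE /= mxE => /negPf->; rewrite andbF.
have TdB j : supported T (dB j).
  by move=> l' j'; rewrite inE /= mxE => /negPf->.
have S0 : supported S (0 : 'M[R]_(m, k)) by move=> i' l' _; rewrite mxE.
have T0 : supported T (0 : 'M[R]_(k, n)) by move=> i' l' _; rewrite mxE.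
pose N0 := (#|S| + #|T|)%N.
pose run (A : 'M[R]_(m, k)) (B : 'M[R]_(k, n)) :=
  exec_straight_line (entries_on S A ++ entries_on T B) p.
have szI (A : 'M[R]_(m, k)) (B : 'M[R]_(k, n)) :
    size (entries_on S A ++ entries_on T B) = N0.
  by rewrite size_cat !size_entries_on.
have v11 i j i' j' : (run (dA i) (dB j))`_(out i' j') = ((i' == i) && (j' == j))%:R.
  by rewrite /run Hout // mul_delta_mx mxE.
have v10 i i' j' : (run (dA i) 0)`_(out i' j') = 0 by rewrite /run Hout // mulmx0 mxE.
have v01 j i' j' : (run 0 (dB j))`_(out i' j') = 0 by rewrite /run Hout // mul0mx mxE.
(* An input register depends on one of the two matrices only, while an entry of the product vanishes
   as soon as the other matrix is 0. *)
have out_ge i j : (N0 <= out i j)%N.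
  rewrite leqNgt; apply/negP => lto; case/negP: R1; apply/eqP.
  have := v11 i j i j; rewrite !eqxx /= mulr1n => <-.
  rewrite /run nth_exec_straight_line ?szI // nth_cat size_entries_on.
  case: ltnP => HS.
    have := v10 i i j; rewrite /run nth_exec_straight_line ?szI //.
    by rewrite nth_cat size_entries_on HS.
  have := v01 j i j; rewrite /run nth_exec_straight_line ?szI //.
  by rewrite nth_cat size_entries_on ltnNge HS.
have out_lt i j : (out i j - N0 < size p)%N.
  rewrite ltn_subLR // ltnNge; apply/negP => leo; case/negP: R1; apply/eqP.
  have := v11 i j i j; rewrite !eqxx /= mulr1n => <-.
  by rewrite /run nth_default // size_exec_straight_line szI.
pose o (e : 'I_m * 'I_n) : 'I_(size p) := Ordinal (out_lt e.1 e.2).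
have o_inj : injective o.
  move=> [i j] [i' j'] /(congr1 val) /= /eqP.
  rewrite -(eqn_add2l N0) !subnKC // => /eqP eqo.
  have := v11 i j i' j'; rewrite -eqo v11 !eqxx /=.
  by case: eqP => [->|_]; case: eqP => [->|_] //= /eqP; rewrite (negPf R1).
have o_cost e : cost_instr (nth (Const 0) p (o e)) = 1%N.
  case E : (nth _ _ _) => [a| | |] //; case/negP: R1; apply/eqP.
  have Hc A B : (run A B)`_(out e.1 e.2) = a.
    have := nth_exec_const (entries_on S A ++ entries_on T B) (ltn_ord (o e)) E.
    by rewrite szI /= subnKC.
  by have := v11 e.1 e.2 e.1 e.2; rewrite !eqxx /= mulr1n Hc -(Hc (dA e.1) 0) v10 => ->.
rewrite /cost_straight_line (big_nth (Const 0)) big_mkord.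
rewrite (bigID (mem (codom o))) /=; apply: leq_trans (leq_addr _ _).
rewrite (eq_bigr (fun=> 1%N)) => [|i /codomP[e ->]]; last exact: o_cost.
by rewrite sum1_card card_codom // card_prod !card_ord.
Qed.

End MatrixProduct.

(** * Exponents *)

Section Powers.
Variable K : realType.
Implicit Types (n : nat) (a b C : K).

Lemma natpow_ge0 n a : 0 <= n%:R `^ a :> K.
Proof. exact: powR_ge0. Qed.

Lemma natpow_gt0 n a : (0 < n)%N -> 0 < n%:R `^ a :> K.
Proof. by move=> n0; rewrite powR_gt0 // ltr0n. Qed.

Lemma natpowD n a b : (0 < n)%N -> n%:R `^ (a + b) = n%:R `^ a * n%:R `^ b :> K.
Proof. by move=> n0; rewrite powRD // pnatr_eq0 -lt0n n0 implybT. Qed.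

Lemma natpow_le n a b : (0 < n)%N -> a <= b -> n%:R `^ a <= n%:R `^ b :> K.
Proof. by move=> n0; apply: ler_powR; rewrite ler1n. Qed.

Lemma natpow_ge1 n a : (0 < n)%N -> 0 <= a -> 1 <= n%:R `^ a :> K.
Proof. by move=> n0 a0; rewrite -[leLHS](powRr0 n%:R) natpow_le. Qed.

Lemma dim_pow_le n a : (dim_pow n a)%:R <= n%:R `^ a :> K.
Proof. by rewrite truncn_le natpow_ge0. Qed.

Lemma dim_pow_gt0 n a : (0 < n)%N -> 0 <= a -> (0 < dim_pow n a)%N.
Proof. by move=> n0 a0; rewrite truncn_gt0 natpow_ge1. Qed.

Lemma natpow_le_dim_pow n a : (0 < n)%N -> 0 <= a ->
  n%:R `^ a <= 2 * (dim_pow n a)%:R :> K.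
Proof.
move=> n0 a0; have := truncnS_gt (n%:R `^ a : K).
have : 1 <= (dim_pow n a)%:R :> K by rewrite ler1n dim_pow_gt0.
by rewrite -/(dim_pow n a) -natr1; lra.
Qed.

Lemma dim_pow1 n : dim_pow n (1 : K) = n.
Proof. by rewrite /dim_pow powRr1 // natrK. Qed.

Lemma le_natpow_unbounded a b C :
  (forall n, (0 < n)%N -> n%:R `^ a <= C * n%:R `^ b) -> a <= b.
Proof.
move=> H; rewrite leNgt; apply/negP => ltba.
have e0 : 0 < a - b by rewrite subr_gt0.
pose n := (Num.truncn ((`|C| + 1) `^ (a - b)^-1)).+1.
have n0 : (0 < n)%N by [].
have C0 : 0 <= `|C| + 1 by rewrite addr_ge0.
have Hn : `|C| + 1 < n%:R `^ (a - b).
  have := truncnS_gt ((`|C| + 1) `^ (a - b)^-1); rewrite -/n => Hlt.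
  have -> : `|C| + 1 = ((`|C| + 1) `^ (a - b)^-1) `^ (a - b).
    by rewrite -powRrM mulVf ?gt_eqF // powRr1.
  by apply: gt0_ltr_powR; rewrite ?nnegrE ?powR_ge0.
have := H n n0; have -> : a = (a - b) + b by rewrite subrK.
rewrite natpowD // ler_pM2r ?natpow_gt0 // => HC.
by have := ler_norm C; lra.
Qed.

(** For [n > 1] and [k] one less than [up_log 2 n], one has [2 ^ k < n], and Bernoulli's inequality
    for [(2 ^ a) ^ k] gives [k * (2 ^ a - 1) <= n ^ a]. The summand 1 in the constant restores the
    last unit. *)
Lemma up_log_natpow a : 0 < a -> exists C, forall n, (0 < n)%N ->
  (up_log 2 n)%:R <= C * n%:R `^ a.
Proof.
move=> a0; exists ((2 `^ a - 1)^-1 + 1) => n n0.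
have q1 : 1 < 2 `^ a :> K.
  rewrite -[ltLHS]/((fun=> 1) a) -powR1.
  by apply: gt0_ltr_powR; rewrite ?nnegrE ?ltr1n.
have q0 : 0 < (2 `^ a - 1)^-1 :> K by rewrite invr_gt0 subr_gt0.
have [n1|n1] := leqP n 1.
  have -> : n = 1%N by apply/eqP; rewrite eqn_leq n1.
  by rewrite up_log1 powR1 mulr1; lra.
have /andP[Hlt _] := up_log_bounds (isT : (1 < 2)%N) n1.
set k := (up_log 2 n).-1 in Hlt.
have Ek : up_log 2 n = k.+1 by rewrite prednK // up_log_gt0 n1.
have bern (x : K) m : 0 < x -> 1 + m%:R * x <= (1 + x) ^+ m.
  move=> x0; elim: m => [|m IH]; first by rewrite mul0r addr0 expr0.
  rewrite exprS -natr1; have : 0 <= m%:R :> K by [].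
  nra.
have Hk : k%:R * (2 `^ a - 1) <= n%:R `^ a.
  apply: le_trans (_ : (2 ^ k)%:R `^ a <= _); last first.
    by apply: ge0_ler_powR; rewrite ?nnegrE ?ler_nat ?(ltnW Hlt) // ltW.
  rewrite natrX -powR_mulrn // powRAC powR_mulrn ?powR_ge0 //.
  have := bern (2 `^ a - 1) k; rewrite subr_gt0 => /(_ q1).
  have -> : 1 + (2 `^ a - 1) = 2 `^ a :> K by rewrite addrC subrK.
  by move=> Hb; apply: le_trans Hb; rewrite lerDr.
rewrite Ek -natr1 mulrDl mul1r lerD ?natpow_ge1 ?(ltW a0) //.
by rewrite [leRHS]mulrC ler_pdivlMr ?subr_gt0.
Qed.

End Powers.

(** * Rectangular products and the exponent [omega] *)

Section Exponent.
Variables (K : realType) (R : pzRingType).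
Implicit Types (C w d e : K).

(* [P C n a c] bounds the outer dimensions [a] and [c] of a product with inner
   dimension [n]. *)
Definition mm_exponent d w (P : K -> nat -> nat -> nat -> Prop) : Prop :=
  forall C, exists C', forall n a c, (0 < n)%N -> P C n a c ->
    forall (S : {set 'I_a * 'I_n}) (T : {set 'I_n * 'I_c}),
      #|S|%:R <= C * n%:R `^ d -> #|T|%:R <= C * n%:R `^ d ->
      exists2 F : nat, F%:R <= C' * n%:R `^ w & mm_within R F S T.

Lemma sparse_mm_exponentE d e1 e2 w :
  sparse_mm_exponent R d e1 1 e2 w <->
  mm_exponent d w (fun _ n a c => a = dim_pow n e1 /\ c = dim_pow n e2).
Proof.
split=> H C; have [C' HC'] := H C; exists C'.
  move=> n a c n0 [-> ->]; have := HC' n n0; rewrite dim_pow1 => {}H S T HS HT.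
  have [p /computes_product_mm_within Hp cp] := H S T HS HT.
  by exists (cost_straight_line p).
move=> n n0; have := HC' n _ _ n0 (conj erefl erefl); rewrite dim_pow1 => {}H S T HS HT.
have [F HF /mm_within_computes_product[p Hp cp]] := H S T HS HT.
by exists p => //; apply: le_trans HF; rewrite ler_nat.
Qed.

Lemma mm_exponent_sub d w w' (P P' : K -> nat -> nat -> nat -> Prop) :
  (forall C n a c, (0 < n)%N -> P' C n a c -> P C n a c) -> w <= w' ->
  mm_exponent d w P -> mm_exponent d w' P'.
Proof.
move=> PP' lew H C; have [C' HC'] := H C; exists `|C'| => n a c n0 HP S T HS HT.
have [F HF ?] := HC' n a c n0 (PP' _ _ _ _ n0 HP) S T HS HT; exists F => //.
apply: le_trans HF _; apply: le_trans (ler_wpM2r (natpow_ge0 _ _) (ler_norm _)) _.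
by rewrite ler_wpM2l // natpow_le.
Qed.

Lemma mm_exponentU d w (P P' : K -> nat -> nat -> nat -> Prop) :
  mm_exponent d w P -> mm_exponent d w P' ->
  mm_exponent d w (fun C n a c => P C n a c \/ P' C n a c).
Proof.
move=> H H' C; have [D HD] := H C; have [D' HD'] := H' C.
exists (Num.max D D') => n a c n0 HP S T HS HT.
have [F HF ?] : exists2 F : nat, F%:R <= D * n%:R `^ w \/ F%:R <= D' * n%:R `^ w
    & mm_within R F S T.
  by case: HP => [/HD|/HD'] /(_ n0 S T HS HT)[F HF ?]; exists F; auto.
exists F => //; case: HF => HF; apply: le_trans HF _;
  by rewrite ler_wpM2r ?natpow_ge0 // le_max lexx ?orbT.
Qed.

(** The witness [1 + d] comes from the naive product. On an empty set [omega] would be a mere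
    default value of [inf]. *)
Lemma omega_set_nonempty d e1 e2 : 0 <= d -> e1 <= 1 ->
  ([set w | 0 <= w /\ sparse_mm_exponent R d e1 1 e2 w] !=set0)%classic.
Proof.
move=> d0 e11; exists (1 + d); split; first by rewrite addr_ge0.
apply/sparse_mm_exponentE => C; exists (2 * C) => n a c n0 [-> ->] S T HS HT.
exists (dim_pow n e1 * (2 * #|T|))%N; last exact: mm_within_naive.
rewrite natrM natrM natpowD // powRr1 //.
have H1 : (dim_pow n e1)%:R <= n%:R :> K.
  by apply: le_trans (dim_pow_le _ _) _; rewrite -[leRHS]powRr1 // natpow_le.
have -> : 2 * C * (n%:R * n%:R `^ d) = n%:R * (2 * (C * n%:R `^ d)) by ring.
by rewrite ler_pM // ?mulr_ge0 // ler_wpM2l.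
Qed.

Lemma omega_lbound d e1 e2 :
  has_lbound [set w : K | 0 <= w /\ sparse_mm_exponent R d e1 1 e2 w]%classic.
Proof. by exists 0 => w []. Qed.

Lemma omega_le d e1 e2 w : 0 <= w -> sparse_mm_exponent R d e1 1 e2 w ->
  omega R d e1 1 e2 <= w.
Proof. by move=> w0 Hw; apply: ge_inf => //; exact: omega_lbound. Qed.

Lemma omega_ge0 d e1 e2 : 0 <= d -> e1 <= 1 -> 0 <= omega R d e1 1 e2.
Proof.
by move=> d0 e11; apply: lb_le_inf; [exact: omega_set_nonempty|move=> w []].
Qed.

Lemma omega_lt d e1 e2 w : 0 <= d -> e1 <= 1 -> omega R d e1 1 e2 < w ->
  sparse_mm_exponent R d e1 1 e2 w.
Proof.
move=> d0 e11 /inf_lt[]; first exact: omega_set_nonempty.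
move=> v [v0 /sparse_mm_exponentE Hv] ltvw; apply/sparse_mm_exponentE.
by apply: mm_exponent_sub Hv => //; apply: ltW.
Qed.

(** Truncation in [dim_pow] loses at most a factor 2, which is the 2 in the constant; the summand 1
    pays for the incomplete last block. *)
Lemma block_count n a e1 d1 C : (0 < n)%N -> 0 <= e1 -> 0 <= d1 ->
  a%:R <= C * n%:R `^ (e1 + d1) ->
  ((a %/ dim_pow n e1).+1)%:R <= (2 * `|C| + 1) * n%:R `^ d1 :> K.
Proof.
move=> n0 e10 d10 Ha; have m0 := dim_pow_gt0 n0 e10.
set m := dim_pow n e1 in m0 *.
rewrite -natr1 mulrDl mul1r lerD ?natpow_ge1 //.
have m0' : 0 < m%:R :> K by rewrite ltr0n.
rewrite -(ler_pM2r m0') -natrM; apply: le_trans (_ : a%:R <= _).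
  by rewrite ler_nat leq_trunc_div.
apply: le_trans Ha _; rewrite natpowD //.
have Hm := natpow_le_dim_pow n0 e10; rewrite -/m in Hm.
apply: le_trans (_ : `|C| * (2 * m%:R * n%:R `^ d1) <= _); last by lra.
apply: le_trans (_ : `|C| * (n%:R `^ e1 * n%:R `^ d1) <= _).
  by rewrite ler_wpM2r ?ler_norm // mulr_ge0 ?natpow_ge0.
by rewrite ler_wpM2l // ler_wpM2r ?natpow_ge0.
Qed.

(** Up to a constant there are at most [n ^ (d1 + d2)] pairs of blocks of the dimensions for which
    [omega] is defined. The inequality with [w] is strict because the infimum need not be
    attained. *)
Lemma mm_exponent_blocks d e1 e2 d1 d2 w :
  0 <= d -> 0 <= e1 <= 1 -> 0 <= e2 -> 0 <= d1 -> 0 <= d2 ->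
  omega R d e1 1 e2 < w ->
  mm_exponent d (w + d1 + d2) (fun C n a c =>
    a%:R <= C * n%:R `^ (e1 + d1) /\ c%:R <= C * n%:R `^ (e2 + d2)).
Proof.
move=> d0 /andP[e10 e11] e20 d10 d20 /(omega_lt d0 e11)/sparse_mm_exponentE H C.
have [C' HC'] := H C; exists ((2 * `|C| + 1) * (2 * `|C| + 1) * `|C'|).
move=> n a c n0 [Ha Hc] S T HS HT.
pose F := Num.truncn (`|C'| * n%:R `^ w).
have F0 : 0 <= `|C'| * n%:R `^ w by rewrite mulr_ge0 ?natpow_ge0.
exists ((a %/ dim_pow n e1).+1 * (c %/ dim_pow n e2).+1 * F)%N.
  have := block_count n0 e10 d10 Ha; have := block_count n0 e20 d20 Hc.
  move: (a %/ dim_pow n e1).+1 (c %/ dim_pow n e2).+1 => pa pc Hpc Hpa.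
  have HF : F%:R <= `|C'| * n%:R `^ w by rewrite truncn_le.
  rewrite !natrM !natpowD //.
  set x := n%:R `^ w in HF *; set y := n%:R `^ d1 in Hpa *; set z := n%:R `^ d2 in Hpc *.
  apply: le_trans (_ : ((2 * `|C| + 1) * y) * ((2 * `|C| + 1) * z) * (`|C'| * x) <= _).
    by rewrite ler_pM ?mulr_ge0 // ler_pM.
  by rewrite le_eqVlt; apply/orP; left; apply/eqP; ring.
apply: (@mm_within_blocks _ _ _ _ _ (dim_pow n e1) (dim_pow n e2)).
- by rewrite ltnW // ltn_ceil // dim_pow_gt0.
- by rewrite ltnW // ltn_ceil // dim_pow_gt0.
move=> S0 T0 HS0 HT0; have [| |F0' HF0' HW] := HC' n _ _ n0 (conj erefl erefl) S0 T0.
- by apply: le_trans HS; rewrite ler_nat.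
- by apply: le_trans HT; rewrite ler_nat.
apply: mm_within_leq HW; rewrite truncn_ge_nat //.
by apply: le_trans HF0' _; rewrite ler_wpM2r ?natpow_ge0 // ler_norm.
Qed.

Lemma dim_pow_le_mul n e e' C : (0 < n)%N -> 1 <= C -> e <= e' ->
  (dim_pow n e)%:R <= C * n%:R `^ e' :> K.
Proof.
move=> n0 C1 lee; apply: le_trans (dim_pow_le _ _) _.
apply: le_trans (natpow_le n0 lee) _.
by rewrite -[leLHS]mul1r ler_wpM2r ?natpow_ge0.
Qed.

(** Along the line [e1 + e2 = dout] one dimension grows while the other shrinks; only the growing
    one has to be cut into blocks. *)
Lemma omega_move d e1 e2 e1' e2' t :
  0 <= d -> 0 <= t -> 0 <= e1 <= 1 -> 0 <= e2 -> e1' <= 1 ->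
  (e1' <= e1 + t /\ e2' <= e2 \/ e1' <= e1 /\ e2' <= e2 + t) ->
  omega R d e1' 1 e2' <= omega R d e1 1 e2 + t.
Proof.
move=> d0 t0 e1P e20 e1'1 He; apply/ler_addgt0Pr => eps eps0.
have om0 : 0 <= omega R d e1 1 e2 by apply: omega_ge0; case/andP: e1P.
apply: omega_le; first by rewrite !addr_ge0 // ltW.
apply/sparse_mm_exponentE => C.
have Hlt : omega R d e1 1 e2 < omega R d e1 1 e2 + eps by rewrite ltrDl.
(* In [mm_exponent_blocks] the constant bounds the dimensions as well, so it has to be at least
   1. *)
have [C' HC'] : exists C', forall n a c, (0 < n)%N ->
    a = dim_pow n e1' /\ c = dim_pow n e2' ->
    forall (S : {set 'I_a * 'I_n}) (T : {set 'I_n * 'I_c}),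
      #|S|%:R <= (`|C| + 1) * n%:R `^ d -> #|T|%:R <= (`|C| + 1) * n%:R `^ d ->
      exists2 F : nat, F%:R <= C' * n%:R `^ (omega R d e1 1 e2 + eps + t)
      & mm_within R F S T.
  have C1 : 1 <= `|C| + 1 by rewrite lerDr.
  case: He => -[He1 He2].
    have [C' HC'] := mm_exponent_blocks d0 e1P e20 t0 (lexx 0) Hlt (`|C| + 1).
    exists C' => n a c n0 [-> ->] S T HS HT.
    have [|F HF HW] := HC' n _ _ n0 _ S T HS HT.
      by split; apply: dim_pow_le_mul; rewrite ?addr0.
    by exists F => //; rewrite addr0 in HF.
  have [C' HC'] := mm_exponent_blocks d0 e1P e20 (lexx 0) t0 Hlt (`|C| + 1).
  exists C' => n a c n0 [-> ->] S T HS HT.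
  have [|F HF HW] := HC' n _ _ n0 _ S T HS HT.
    by split; apply: dim_pow_le_mul; rewrite ?addr0.
  by exists F => //; rewrite addr0 in HF.
exists C' => n a c n0 Hac S T HS HT; rewrite addrAC.
have HCC : C * n%:R `^ d <= (`|C| + 1) * n%:R `^ d.
  by rewrite ler_wpM2r ?natpow_ge0 //; have := ler_norm C; lra.
by apply: HC' => //; [apply: le_trans HS HCC|apply: le_trans HT HCC].
Qed.

(** A full column times a full row is an admissible instance, since [n <= n ^ d]. The factor 4 in
    the proof makes up for the truncation of both dimensions. *)
Lemma omega_ge d e1 e2 : (1 : R) != 0 -> 1 <= d -> 0 <= e1 <= 1 -> 0 <= e2 <= 1 ->
  e1 + e2 <= omega R d e1 1 e2.
Proof.
move=> R1 d1 /andP[e10 e11] /andP[e20 e21]; apply: lb_le_inf.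
  by apply: omega_set_nonempty => //; lra.
move=> w [w0 Hw]; have [C' HC'] := Hw 1; apply: (@le_natpow_unbounded _ _ _ (4 * C')).
move=> n n0; have := HC' n n0; rewrite dim_pow1 => {}HC'.
pose l : 'I_n := Ordinal n0.
have [||p Hp cp] := HC' [set e | e.2 == l] [set e | e.1 == l].
- have -> : [set e : 'I_(dim_pow n e1) * 'I_n | e.2 == l] = finset.setX finset.setT [set l]%SET.
    by apply/setP => e; rewrite !inE.
  rewrite cardsX cards1 cardsT card_ord muln1 mul1r.
  by apply: (le_trans (dim_pow_le n e1)); rewrite natpow_le //; lra.
- have -> : [set e : 'I_n * 'I_(dim_pow n e2) | e.1 == l] = finset.setX [set l]%SET finset.setT.
    by apply/setP => e; rewrite !inE andbT.
  rewrite cardsX cards1 cardsT card_ord mul1n mul1r.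
  by apply: (le_trans (dim_pow_le n e2)); rewrite natpow_le //; lra.
have := outer_product_cost R1 Hp; rewrite -(ler_nat K) natrM => Hcost.
have H1 := natpow_le_dim_pow n0 e10; have H2 := natpow_le_dim_pow n0 e20.
rewrite natpowD //.
apply: le_trans (_ : (2 * (dim_pow n e1)%:R) * (2 * (dim_pow n e2)%:R) <= _).
  by rewrite ler_pM ?natpow_ge0.
by move: Hcost cp; lra.
Qed.

End Exponent.

(** * The maximum over all splittings of [dout] *)

Section MaximalExponent.
Import numFieldNormedType.Exports.
Variables (K : realType) (R : pzRingType).
Implicit Types (C w d e dout t : K).

Lemma lipschitz1_continuous (g : K -> K) :
  (forall x y, g y <= g x + `|x - y|) -> continuous g.
Proof.
move=> Hg x; apply/cvgrPdist_lt => e e0; apply/nbhs_ballP; exists e => //= y.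
rewrite /ball /= => Hxy; apply: le_lt_trans Hxy.
by rewrite ler_norml; have := Hg x y; have := Hg y x; rewrite (distrC y x); lra.
Qed.

Lemma omega_values_max d dout : 1 <= d -> 0 <= dout <= 2 ->
  exists beta : K, is_max (omega_values R d dout) beta.
Proof.
move=> d1 /andP[dout0 dout2].
(* [lo <= e1 <= hi] says that [e1] and [dout - e1] both lie in [0, 1]. Clipping extends the function
   to the whole line, where its Lipschitz bound gives continuity. *)
pose lo : K := Num.max 0 (dout - 1); pose hi : K := Num.min 1 dout.
pose clip t := Num.max lo (Num.min hi t).
have lohi : lo <= hi by rewrite /lo /hi le_min !ge_max; apply/andP; split; lra.
have clipP t : lo <= clip t <= hi.
  by rewrite /clip le_max lexx /= ge_max lohi ge_min lexx.
have clip_id t : lo <= t <= hi -> clip t = t.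
  by case/andP=> h1 h2; rewrite /clip (min_idPr h2) (max_idPr h1).
have rangeP t : lo <= t <= hi <-> [/\ 0 <= t, t <= 1, 0 <= dout - t & dout - t <= 1].
  rewrite /lo /hi ge_max le_min; split.
    by case/andP => /andP[? ?] /andP[? ?]; split; lra.
  by case=> *; apply/andP; split; apply/andP; split; lra.
have clip_le x y : clip y <= clip x + `|x - y|.
  have := ler_norm (x - y); have := ler_norm (y - x); rewrite (distrC y x).
  have := normr_ge0 (x - y); rewrite /clip.
  case: (leP hi x); case: (leP hi y) => hy hx; rewrite ?maxEle;
    repeat case: ifP; move=> *; lra.
pose g t := omega R d (clip t) 1 (dout - clip t).
have g_lip x y : g y <= g x + `|x - y|.
  have /rangeP[x0 x1 x0' x1'] := clipP x; have /rangeP[y0 y1 y0' y1'] := clipP y.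
  rewrite /g; apply: omega_move => //; first by lra.
    by rewrite x0.
  have := clip_le x y; have := clip_le y x; rewrite (distrC y x) => h1 h2.
  by case: (leP (clip x) (clip y)) => ?; [left|right]; split; lra.
have gc : {within `[lo, hi], continuous g}%classic.
  by apply: continuous_subspaceT; apply: lipschitz1_continuous.
have [c cP Hc] := EVT_max lohi gc.
exists (g c); split.
  have /rangeP[? ? ? ?] := clipP c.
  exists (clip c), (dout - clip c); split=> //; first by apply/andP.
    by apply/andP.
  by rewrite addrC subrK.
move=> w [e1 [e2 [/andP[e10 e11] /andP[e20 e21] De ->]]].
have e1P : lo <= e1 <= hi by apply/rangeP; split; lra.
have -> : e2 = dout - e1 by lra.
by have := Hc e1; rewrite /g clip_id // in_itv /= => /(_ e1P).
Qed.

Lemma mm_within_empty m k n (S : {set 'I_m * 'I_k}) (T : {set 'I_k * 'I_n}) :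
  (m * n)%N = 0%N -> mm_within R 0 S T.
Proof.
move/eqP; rewrite muln_eq0 => /orP[]/eqP mn0.
  by apply: mm_within_leq (@mm_within_naive R m k n S T); rewrite mn0 mul0n.
apply: mm_within_leq (@mm_within_naive R m k n S T); rewrite leqn0.
rewrite (_ : #|T| = 0%N) ?muln0 //; apply: eq_card0 => -[i j].
by have := ltn_ord j; rewrite [X in (_ < X)%N]mn0.
Qed.

Definition rect_dims dout e C (n a c : nat) : Prop :=
  [/\ a%:R <= C * n%:R `^ e, a%:R <= C * n%:R, c%:R <= C * n%:R
    & (a * c)%:R <= C * n%:R `^ dout].

(* A grid of exponents e for the first dimension, of step eps / 2, reduces to
   finitely many values of omega, whose hidden constants have a maximum. *)
Lemma mm_exponent_rect d dout beta eps :
  1 <= d -> 0 <= dout <= 2 -> 0 < eps ->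
  (forall w, omega_values R d dout w -> w <= beta) ->
  mm_exponent R d (beta + eps) (fun C n a c =>
    [/\ a%:R <= C * n%:R, c%:R <= C * n%:R & (a * c)%:R <= C * n%:R `^ dout]).
Proof.
move=> d1 /andP[dout0 dout2] eps0 Hbeta.
have d0 : 0 <= d by lra.
pose lo : K := Num.max 0 (dout - 1); pose hi : K := Num.min 1 dout.
pose e_ (g : nat) : K := Num.min hi (lo + g%:R * (eps / 2)).
have lohi : lo <= hi by rewrite /lo /hi le_min !ge_max; apply/andP; split; lra.
have e_P g : lo <= e_ g <= hi.
  rewrite /e_ le_min lohi ge_min lexx /= lerDl andbT.
  by apply: mulr_ge0 => //; lra.
have rangeP t : lo <= t <= hi -> [/\ 0 <= t <= 1, 0 <= dout - t <= 1
    & omega R d t 1 (dout - t) <= beta].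
  rewrite /lo /hi ge_max le_min => /andP[/andP[? ?] /andP[? ?]].
  have h1 : 0 <= t <= 1 by apply/andP.
  have h2 : 0 <= dout - t <= 1 by apply/andP; split; lra.
  split=> //; apply: Hbeta; exists t, (dout - t); split=> //; lra.
suff claim g : mm_exponent R d (beta + eps) (rect_dims dout (e_ g)).
  (* With [g] steps of length [eps / 2] the grid reaches [hi], where the bound on [a] follows from
     the others. *)
  pose g := (Num.truncn (hi / (eps / 2))).+1.
  have eg : e_ g = hi.
    apply/min_idPl; apply: le_trans (_ : g%:R * (eps / 2) <= _).
      by rewrite -ler_pdivrMr ?divr_gt0 // ltW // truncnS_gt.
    by rewrite lerDr /lo le_max lexx.
  (* If [a * c = 0], the bound on [a * c] controls neither dimension. *)
  have empty : mm_exponent R d (beta + eps) (fun _ n a c => (a * c)%N = 0%N).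
    move=> C; exists 0 => n a c n0 ac0 S T _ _; exists 0%N; rewrite ?mul0r //.
    exact: mm_within_empty.
  apply: mm_exponent_sub (mm_exponentU empty (claim g)) => // C n a c n0 [Ha Hc Hac].
  case: (posnP (a * c)) => [|ac0]; [by left|right; split=> //].
  rewrite eg /hi; case: (leP 1 dout) => _; first by rewrite powRr1.
  apply: le_trans Hac; rewrite ler_nat leq_pmulr //.
  by move: ac0; rewrite muln_gt0 => /andP[].
have omega_lt t x : lo <= t <= hi -> 0 < x -> omega R d t 1 (dout - t) < beta + x.
  by move=> /rangeP[_ _ h] x0; lra.
elim: g => [|g IH].
  have E0 : e_ 0%N = lo by rewrite /e_ mul0r addr0; apply/min_idPr.
  have loP : lo <= lo <= hi by rewrite lexx.
  have [lo01 /andP[lo0' lo1'] _] := rangeP _ loP.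
  have empty : mm_exponent R d (beta + eps) (fun _ n a c => (a * c)%N = 0%N).
    move=> C; exists 0 => n a c n0 ac0 S T _ _; exists 0%N; rewrite ?mul0r //.
    exact: mm_within_empty.
  have := mm_exponent_blocks d0 lo01 lo0' (lexx 0) (lexx 0) (omega_lt _ _ loP eps0).
  rewrite !addr0 => block.
  apply: mm_exponent_sub (mm_exponentU empty block) => // C n a c n0 [Ha _ Hc Hac].
  case: (posnP (a * c)) => [|ac0]; [by left|right; split=> //].
    by rewrite -E0.
  rewrite /lo; case: (leP 0 (dout - 1)) => _.
    by rewrite opprB addrC subrK powRr1.
  rewrite subr0; apply: le_trans Hac; rewrite ler_nat leq_pmull //.
  by move: ac0; rewrite muln_gt0 => /andP[].
have [e01 /andP[e0' e1'] _] := rangeP _ (e_P g).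
have eps20 : 0 < eps / 2 by rewrite divr_gt0.
have := mm_exponent_blocks d0 e01 e0' (ltW eps20) (lexx 0)
  (omega_lt _ _ (e_P g) eps20).
(* One [eps / 2] is the slack above the infimum, the other the price of cutting the first dimension
   into blocks. *)
have -> : beta + eps / 2 + eps / 2 + 0 = beta + eps by lra.
rewrite addr0 => block C.
have [D HD] := mm_exponentU IH block (`|C| + 1).
exists D => n a c n0 [Ha Ha' Hc Hac] S T HS HT.
have HC : C <= `|C| + 1 by have := ler_norm C; lra.
have leC x y : 0 <= y -> x <= C * y -> x <= (`|C| + 1) * y.
  by move=> y0 h; apply: le_trans h _; apply: ler_wpM2r.
apply: HD => //; try by apply: leC; rewrite ?natpow_ge0.
(* A dimension [a] up to [n ^ e_ g] falls under the previous grid point. Otherwise the bound on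
   [a * c] forces [c <= C * n ^ (dout - e_ g)], and [a] exceeds [n ^ e_ g] by a factor
   [n ^ (eps / 2)] at most, up to a constant. *)
case: (leP a%:R (n%:R `^ e_ g)) => Hag; [left|right].
  split; try by apply: leC; rewrite ?natpow_ge0.
  by apply: le_trans Hag _; rewrite -[leLHS]mul1r ler_wpM2r ?natpow_ge0 // lerDr.
split.
  apply: leC; rewrite ?natpow_ge0 //; apply: le_trans Ha _.
  have C0 : 0 <= C.
    rewrite -(pmulr_lge0 _ (_ : 0 < n%:R)) ?ltr0n //.
    exact: le_trans Ha'.
  rewrite ler_wpM2l // natpow_le // /e_ -natr1 mulrDl mul1r addrA.
  by rewrite /Num.min; case: ifP; case: ifP; lra.
have a0 : 0 < a%:R :> K by apply: le_lt_trans Hag; apply: natpow_ge0.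
apply: leC; rewrite ?natpow_ge0 //.
have ng : 0 < n%:R `^ e_ g :> K by rewrite natpow_gt0.
rewrite -(ler_pM2l ng) mulrCA -natpowD // [e_ g + _]addrC subrK.
by apply: le_trans Hac; rewrite natrM ler_wpM2r // ltW.
Qed.

End MaximalExponent.

(** * Computation trees *)

Section Trees.
Variables (R : pzRingType) (n : nat).

Definition tree_output (t : ctree R (sparse nat n n)) (s : seq R) :
    sparse R n n :=
  let: (o, s') := exec_ctree t s in
  map_tuple (fun c => [seq (x.1, s'`_(x.2)) | x <- c]) o.

Definition run_first (p : straight_line R) (t : ctree R (sparse nat n n)) :=
  foldr (@Step R (sparse nat n n)) t p.

Lemma exec_run_first p t s :
  exec_ctree (run_first p t) s = exec_ctree t (exec_straight_line s p).
Proof. by elim: p s => //= c p IH s; rewrite IH. Qed.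

Lemma cost_run_first p t s :
  cost_ctree (run_first p t) s =
  (cost_straight_line p + cost_ctree t (exec_straight_line s p))%N.
Proof.
elim: p s => /= [|c p IH] s; first by rewrite /cost_straight_line big_nil.
by rewrite IH /cost_straight_line big_cons addnA.
Qed.

Variable X : Type.
Implicit Types (s : seq (X -> R)) (D : set X) (G : X -> sparse R n n -> Prop).

(** [D] is the set of inputs that reach the current node; it carries what earlier tests have
    revealed. *)
Definition solves (c : nat) D s G : Prop :=
  exists t : ctree R (sparse nat n n), forall x, D x ->
    (cost_ctree t (regs s x) <= c)%N /\ G x (tree_output t (regs s x)).

Lemma solves_leq c c' D s G : (c <= c')%N -> solves c D s G -> solves c' D s G.
Proof.
move=> lec [t Ht]; exists t => x /Ht[ct Gt]; split=> //; exact: leq_trans lec.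
Qed.

Lemma solves_leaf D s G (rows : 'I_n -> seq 'I_n) (V : 'I_n -> 'I_n -> X -> R) :
  (forall i j, i \in rows j -> held s (V i j)) ->
  (forall x, D x -> G x [tuple [seq (i, V i j x) | i <- rows j] | j < n]) ->
  solves 0 D s G.
Proof.
move=> HV HG.
have /choice[reg Hreg] : forall ij : 'I_n * 'I_n, exists k, ij.1 \in rows ij.2 ->
    forall x, (regs s x)`_k = V ij.1 ij.2 x.
  move=> [i j] /=; case: (boolP (i \in rows j)) => [/HV[k _ Hk]|_]; last by exists 0%N.
  by exists k.
exists (Leaf R [tuple [seq (i, reg (i, j)) | i <- rows j] | j < n]) => x Dx.
split=> //; rewrite /tree_output /=; have := HG x Dx; congr (G x _).
apply: eq_from_tnth => j; rewrite [RHS]tnth_map !tnth_mktuple -map_comp.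
apply/eq_in_map => i ir /=; congr pair; symmetry.
exact: (Hreg (i, j)).
Qed.

Lemma solves_step c c' P Q D s G :
  computable c P Q -> (forall f, P f -> held s f) ->
  (forall s', (forall f, held s f -> held s' f) -> (forall f, Q f -> held s' f) ->
     solves c' D s' G) ->
  solves (c + c') D s G.
Proof.
move=> Hc HP H; have [s' [p [cp Ep HQ]]] := Hc s HP.
have [|//|t Ht] := H (s ++ s'); first by move=> f; apply: held_cat.
exists (run_first p t) => x /Ht[ct Gt].
by rewrite cost_run_first /tree_output exec_run_first Ep leq_add.
Qed.

Lemma solves_test c D s G f : held s f ->
  solves c (D `&` [set x | f x = 0])%classic s G ->
  solves c (D `&` [set x | f x <> 0])%classic s G ->
  solves c.+1 D s G.
Proof.
move=> [i _ Hi] [t0 H0] [t1 H1]; exists (IfZero i t0 t1) => x Dx.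
rewrite /tree_output /= Hi ltnS; case: eqP => fx.
  by apply: H0.
by apply: H1.
Qed.

(** The tree may have [2 ^ size r] branches, but each input passes only [size r] tests. *)
Lemma solves_test_all (I : eqType) (r : seq I) (F : I -> X -> R) c D s G :
  (forall i, i \in r -> held s (F i)) ->
  (forall D', (D' `<=` D)%classic ->
     (forall i x y, i \in r -> D' x -> D' y -> (F i x == 0) = (F i y == 0)) ->
     solves c D' s G) ->
  solves (c + size r) D s G.
Proof.
elim: r D => [|i r IH] D Hh H; first by rewrite addn0; apply: H.
rewrite addnS; have Hr j : j \in r -> held s (F j).
  by move=> jr; apply: Hh; rewrite inE jr orbT.
apply: (solves_test (Hh i (mem_head _ _))); apply: IH => // D' sub H';
  apply: H => [x /sub[] //|j x y]; rewrite inE => /predU1P[->|jr] Dx Dy;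
  try by apply: H'.
- by have [[_ ->] [_ ->]] := (sub _ Dx, sub _ Dy).
- by have [[_ /eqP/negPf->] [_ /eqP/negPf->]] := (sub _ Dx, sub _ Dy).
Qed.

End Trees.

(** * Peeling *)

Section HashedProduct.
Variables (R : pzRingType) (X : Type) (n b : nat).
Variables (A B : X -> 'M[R]_n) (S T : {set 'I_n * 'I_n}).
Hypothesis HA : forall x, supported S (A x).
Hypothesis HB : forall x, supported T (B x).

(** A position of [A] contributes to at most one entry of the hashed matrix, so hashing takes at
    most [#|S|] additions. Summing the masked rows of a bucket commutes with multiplication by
    [B]. *)
Lemma computable_hashed_product (F : nat) (J : {set 'I_n}) (g : 'I_n -> 'I_b)
    (mask : pred 'I_n) :
  (forall (S' : {set 'I_b * 'I_n}) (T' : {set 'I_n * 'I_#|J|}),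
     (#|S'| <= #|S|)%N -> (#|T'| <= #|T|)%N -> mm_within R F S' T') ->
  computable (#|S| + F) (entries_in S A `|` entries_in T B)%classic
    [set f | exists beta j, j \in J /\
       f = (fun x => \sum_(i | (g i == beta) && mask i) (A x *m B x) i j)]%classic.
Proof.
move=> HF; pose A' x : 'M[R]_(b, n) :=
  \matrix_(beta, l) \sum_(i | (g i == beta) && mask i) A x i l.
pose S' : {set 'I_b * 'I_n} := [set (g p.1, p.2) | p in [set p in S | mask p.1]].
have cS' : (#|S'| <= #|S|)%N.
  apply: leq_trans (leq_imset_card _ _) _; apply/subset_leq_card/fintype.subsetP => p.
  by rewrite inE => /andP[].
have HA' x : supported S' (A' x).
  move=> beta l nS'; rewrite mxE big1 // => i /andP[/eqP gi mi].
  apply: HA; apply: contra nS' => iS; rewrite -gi.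
  by apply/imsetP; exists (i, l) => //; rewrite inE iS.
pose Q (e : 'I_b * 'I_n) := [set p in S | mask p.1 & (g p.1, p.2) == e].
have HQ e x : \sum_(p <- enum (Q e)) A x p.1 p.2 = A' x e.1 e.2.
  rewrite big_enum_cond /= big_mkcond /=.
  rewrite (eq_bigr (fun p => if (p.1, p.2) \in Q e then A x p.1 p.2 else 0));
    last by move=> [i l] _; rewrite andbT.
  rewrite -(pair_bigA _ (fun i l => if (i, l) \in Q e then A x i l else 0)) /=.
  rewrite mxE [RHS]big_mkcond /=; apply: eq_bigr => i _.
  rewrite (eq_bigr (fun l => if l == e.2 then
    if (g i == e.1) && mask i then A x i e.2 else 0 else 0)); last first.
    move=> l _; rewrite !inE /= -pair_eqE /= /pair_eq /=.
    case: (l =P e.2) => [->|_]; rewrite ?andbF // ?andbT.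
    case: (boolP ((i, e.2) \in S)) => [_|/HA->]; rewrite ?if_same //=.
    by rewrite andbC.
  by rewrite -big_mkcond big_pred1_eq.
have H1 : forall e : 'I_b * 'I_n, e \in enum {: 'I_b * 'I_n} ->
    computable #|Q e| (entries_in S A `|` entries_in T B)%classic
      [set (fun x => A' x e.1 e.2)]%classic.
  move=> e _; have := @computable_sum R X _ (enum (Q e)) (fun p x => A x p.1 p.2)
    (entries_in S A `|` entries_in T B)%classic.
  rewrite -cardE (funext (HQ e)); apply => p; rewrite mem_enum inE => /andP[pS _].
  by left; exists p.
have H2 := @mm_within_piece R F b n n b #|J| S' T Some
  (fun j => Some (enum_val j)) X A' B HA' HB (HF _ _ _ _).
apply: (computable_sub (computable_trans (computable_big H1)
  (computable_sub (H2 _ _) (leqnn _) _ (fun f h => h)))).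
- by apply: leq_trans cS'; apply: (@card_piece_rows _ _ _ S' Some) => i i' j [->] [->].
- apply: (@card_piece_cols _ _ _ T (fun j => Some (enum_val j))).
  by move=> j j' l [<-] [/enum_val_inj->].
- move=> f [[e eS' ->]|h]; [right|by left; right].
  by exists e; rewrite ?mem_enum.
- rewrite leq_add2r big_enum /=.
  rewrite [X in (X <= _)%N](_ : _ = #|[set p in S | mask p.1]|).
    by apply/subset_leq_card/fintype.subsetP => p; rewrite inE => /andP[].
  rewrite -sum1_card (partition_big (fun p => (g p.1, p.2)) xpredT) //=.
  apply: eq_bigr => e _; rewrite -sum1_card; apply: eq_bigl => p.
  by rewrite !inE andbA.
- by [].
- move=> f [beta [j [jJ ->]]]; right.
  exists beta, beta, (enum_rank_in jJ j), j; split=> //.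
    by rewrite enum_rankK_in.
  apply: funext => x; rewrite mxE.
  under [RHS]eq_bigr => l _ do rewrite mxE mulr_suml.
  by rewrite exchange_big /=; apply: eq_bigr => i _; rewrite mxE.
Qed.

End HashedProduct.

(** * Isolation of rows by hashing *)

Section Isolation.
Variables (R : pzRingType) (n rho K : nat).
Variables (h : 'I_rho -> 'I_n -> nat) (r : 'I_rho -> 'I_n -> bool).

(** One hash value per row serves all levels, reduced modulo [2 ^ k]. *)
Definition same_bucket (k : nat) (s : 'I_rho) (i i' : 'I_n) : bool :=
  h s i == h s i' %[mod 2 ^ k].

Definition alone (M : 'M[R]_n) k s i j : Prop :=
  forall i', i' != i -> same_bucket k s i i' -> M i' j = 0.

(** The sum never contains row [i] itself, so it vanishes if [i] is alone. It runs over the rows of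
    the bucket whose bit differs from that of [i], hence it is an entry of a masked hashed
    product. *)
Definition looks_alone (M : 'M[R]_n) k s i j : Prop :=
  forall t, \sum_(i' | same_bucket k s i i' && (r t i' != r t i)) M i' j = 0.

Definition col_nnz (M : 'M[R]_n) (j : 'I_n) : nat := #|[set i | M i j != 0]|.

Definition good_randomness (M : 'M[R]_n) : Prop :=
  forall k, (k <= K)%N -> forall i j,
    (forall s, looks_alone M k s i j -> alone M k s i j) /\
    ((2 * col_nnz M j <= 2 ^ k)%N -> exists s, alone M k s i j).

Lemma alone_looks_alone M k s i j : alone M k s i j -> looks_alone M k s i j.
Proof.
move=> H t; apply: big1 => i' /andP[si rt]; apply: H => //.
by apply: contraNneq rt => ->.
Qed.

Lemma sum_col_nnz M (J : {set 'I_n}) : (\sum_(j in J) col_nnz M j <= nnz M)%N.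
Proof.
apply: leq_trans (_ : \sum_j col_nnz M j <= _)%N.
  by rewrite [leqRHS](bigID (mem J)) leq_addr.
rewrite /nnz -sum1_card (partition_big (fun e => e.2) xpredT) //=.
apply: leq_sum => j _; rewrite sum1dep_card /col_nnz.
rewrite -(card_imset (mem [set i | M i j != 0]) (f := fun i => (i, j))); last by move=> i i' [].
apply/subset_leq_card/fintype.subsetP => _ /imsetP[i + ->].
by rewrite !inE eqxx andbT.
Qed.

End Isolation.

(** * The recursion over the levels *)

Section Peeling.
Variables (R : pzRingType) (n rho K N F : nat) (X : Type).
Variables (h : 'I_rho -> 'I_n -> nat) (r : 'I_rho -> 'I_n -> bool).
Variables (A B : X -> 'M[R]_n) (S T : {set 'I_n * 'I_n}).
Hypothesis HA : forall x, supported S (A x).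
Hypothesis HB : forall x, supported T (B x).
Hypothesis HN : forall x, (nnz (A x *m B x) <= N)%N.
Hypothesis K_ge : (2 * n <= 2 ^ K)%N.
Hypothesis K_le : (2 ^ K <= 4 * n)%N.
Hypothesis HF : forall b c, (b <= 4 * n)%N -> (c <= n)%N ->
  (b = 1 \/ b * c <= 4 * N)%N ->
  forall (S' : {set 'I_b * 'I_n}) (T' : {set 'I_n * 'I_c}),
  (#|S'| <= #|S|)%N -> (#|T'| <= #|T|)%N -> mm_within R F S' T'.

Let M x := A x *m B x.
Let good x := good_randomness K h r (M x).

(** There are [rho] hash functions with [1 + rho * 2] masks each: no mask, or a given value of one
    of [rho] bits. Each hashed product costs [#|S| + F] and has at most [n + 4 * N] entries to be
    tested, the [n] being for level 0. *)
Definition level_cost : nat :=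
  (rho * (1 + rho * 2) * (#|S| + F + n + 4 * N))%N.

Let bucket k s i : 'I_(2 ^ k) := Ordinal (ltn_pmod (h s i) (expn_gt0 2 k)).

(* [None] keeps every row, [Some (t, v)] the rows [i] with [r t i = v]. *)
Let mask (mu : option ('I_rho * bool)) i :=
  if mu is Some (t, v) then r t i == v else true.

Let Z k s mu (beta : 'I_(2 ^ k)) j (x : X) :=
  \sum_(i | (bucket k s i == beta) && mask mu i) M x i j.

Let passes k i j s x := [forall t, Z s (Some (t, ~~ r t i)) (bucket k s i) j x == 0].

Let bucketE k s i i' : (bucket k s i' == bucket k s i) = same_bucket h k s i i'.
Proof. by rewrite -val_eqE /= /same_bucket eq_sym. Qed.

Let passesP k i j s x : reflect (looks_alone h r (M x) k s i j) (passes k i j s x).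
Proof.
have E t : Z s (Some (t, ~~ r t i)) (bucket k s i) j x =
    \sum_(i' | same_bucket h k s i i' && (r t i' != r t i)) M x i' j.
  apply: eq_bigl => i'; rewrite bucketE /=; congr (_ && _).
  by case: (r t i); case: (r t i').
by apply: (iffP forallP) => H t; have := H t; rewrite E => /eqP; auto.
Qed.

Let Z_alone k i j s x : alone h (M x) k s i j ->
  Z s None (bucket k s i) j x = M x i j.
Proof.
move=> H; rewrite /Z (bigD1 i) /= ?eqxx // big1 ?addr0 // => i'.
by rewrite andbT bucketE => /andP[si ne]; apply: H.
Qed.

Let output x (o : sparse R n n) : Prop := good x -> o = sparse_repr (M x).

Let level_ok k (J : {set 'I_n}) := (k == 0)%N || (2 ^ k * #|J| <= 4 * N)%N.

Let P0 := (entries_in S A `|` entries_in T B)%classic.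

Lemma computable_level k J : (k <= K)%N -> level_ok k J ->
  computable (rho * (1 + rho * 2) * (#|S| + F)) P0
    [set f | exists s mu (beta : 'I_(2 ^ k)) j, j \in J /\ f = Z s mu beta j]%classic.
Proof.
move=> lek ok.
have H1 (e : 'I_rho * option ('I_rho * bool)) :=
  @computable_hashed_product R X n (2 ^ k) A B S T HA HB F J (bucket k e.1) (mask e.2).
have {}H1 := computable_big (r := enum {: 'I_rho * option ('I_rho * bool)})
  (fun e _ => H1 e _).
apply: (computable_sub (H1 _)) => //.
- move=> S' T'; apply: HF.
  + by apply: leq_trans K_le; rewrite leq_exp2l.
  + by rewrite -[X in (_ <= X)%N]card_ord max_card.
  + by case/orP: ok => [/eqP->|]; [left; rewrite expn0|right].
- by rewrite big_enum sum_nat_const card_prod card_option card_prod card_bool !card_ord add1n.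
- move=> f [s [mu [beta [j [jJ ->]]]]].
  by exists (s, mu); [rewrite mem_enum|exists beta, j].
Qed.

(** Induction on the number [m] of levels left, [J] being the set of columns not yet recovered. With
    good randomness, a column that survives level [k] has [2 ^ k < 2 * col_nnz], which is the lower
    bound required at level [k.+1]. *)
Lemma solves_level m k (J : {set 'I_n}) (D : set X) s
    (rows : 'I_n -> seq 'I_n) (V : 'I_n -> 'I_n -> X -> R) :
  (k + m = K.+1)%N ->
  (forall f, P0 f -> held s f) ->
  (forall i j, j \notin J -> i \in rows j -> held s (V i j)) ->
  (forall x, D x -> good x -> forall j, j \notin J ->
     [seq (i, V i j x) | i <- rows j] = tnth (sparse_repr (M x)) j) ->
  (forall x, D x -> good x -> forall j, j \in J ->
     (k == 0)%N || (2 ^ k < 4 * col_nnz (M x) j)%N) ->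
  solves (m * level_cost) D s output.
Proof.
elim: m k J D s rows V => [|m IH] k J D s rows V km HP hV okV okJ.
  (* After the last level, [2 ^ K.+1 >= 4 * n] leaves no column in [J] under good randomness; the
     empty lists serve the other seeds. *)
  pose rows' j := if j \in J then [::] else rows j.
  apply: (@solves_leaf _ _ _ D s output rows' V) => [i j|x Dx gx].
    by rewrite /rows'; case: ifPn => // jJ; apply: hV.
  apply: eq_from_tnth => j; rewrite tnth_mktuple /rows'; case: ifPn => jJ.
    exfalso; have := okJ x Dx gx j jJ; have := max_card (mem [set i | M x i j != 0]).
    rewrite card_ord -/(col_nnz _ _); move: km K_ge; rewrite addn0 => ->.
    by rewrite expnS; lia.
  exact: okV.
have leaf D' s' : (forall x, D' x -> ~ good x) -> solves (m.+1 * level_cost) D' s' output.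
  move=> HD; apply: (solves_leq (leq0n _)).
  apply: (@solves_leaf _ _ _ D' s' output (fun=> [::]) V) => // x Dx gx.
  by case: (HD x Dx gx).
(* For [k > 0], summing [2 ^ k < 4 * col_nnz] over [J] gives [2 ^ k * #|J| <= 4 * N], so a larger
   [J] betrays bad randomness and the computation is given up. *)
have [ok|nok] := boolP (level_ok k J); last first.
  apply: leaf => x Dx gx; case/norP: nok => k0; rewrite -ltnNge ltnNge => /negP[].
  apply: leq_trans (_ : 4 * \sum_(j in J) col_nnz (M x) j <= _)%N; last first.
    by rewrite leq_mul2l /=; apply: leq_trans (sum_col_nnz _ _) (HN x).
  rewrite big_distrr /= mulnC -sum_nat_const; apply: leq_sum => j jJ.
  by have := okJ x Dx gx j jJ; rewrite (negPf k0) /=; apply: ltnW.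
have lek : (k <= K)%N by lia.
pose tests := enum (finset.setX [set: ('I_rho * option ('I_rho * bool)) * 'I_(2 ^ k)]%SET J).
have sz_tests : (size tests <= rho * (1 + rho * 2) * (n + 4 * N))%N.
  rewrite -cardE cardsX cardsT !card_prod card_option card_prod card_bool !card_ord.
  rewrite -mulnA add1n leq_mul2l; apply/orP; right.
  have leJ : (#|J| <= n)%N by rewrite -[X in (_ <= X)%N]card_ord max_card.
  case/orP: ok => [/eqP->|]; first by rewrite expn0 mul1n (leq_trans leJ) ?leq_addr.
  by move=> h4; lia.
have -> : (m.+1 * level_cost = rho * (1 + rho * 2) * (#|S| + F) +
    (m * level_cost + rho * (1 + rho * 2) * (n + 4 * N)))%N.
  by rewrite /level_cost; move: (rho * _)%N => q; lia.
apply: (solves_step (computable_level lek ok) HP) => s' mono hQ.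
apply: (solves_leq (c := m * level_cost + size tests)); first by rewrite leq_add2l.
apply: (@solves_test_all _ _ _ _ tests (fun e => Z e.1.1.1 e.1.1.2 e.1.2 e.2)).
  move=> [[[s0 mu] beta] j]; rewrite mem_enum inE => /andP[_ jJ].
  by apply: hQ; exists s0, mu, beta, j.
move=> D' DD' same.
have sameZ s0 mu (beta : 'I_(2 ^ k)) j x y : j \in J -> D' x -> D' y ->
    (Z s0 mu beta j x == 0) = (Z s0 mu beta j y == 0).
  move=> jJ; apply: (same (((s0, mu), beta), j)).
  by rewrite mem_enum inE /= jJ inE.
have [[x0 D0]|nD] := pselect (exists x, D' x); last first.
  apply: (solves_leq (leq0n _)).
  apply: (@solves_leaf _ _ _ D' s' output (fun=> [::]) V) => // x Dx _.
  by case: nD; exists x.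
have sameP i j s0 x : j \in J -> D' x -> passes k i j s0 x = passes k i j s0 x0.
  by move=> jJ Dx; apply: eq_forallb => t; apply: sameZ.
(* A column is recovered once each of its rows passes for some hash. Evaluating at [x0] is
   legitimate by [sameP]. *)
pose done := [set j in J | [forall i, exists s0, passes k i j s0 x0]].
pose V' i j := if j \in done then
    if [pick s0 | passes k i j s0 x0] is Some s0 then Z s0 None (bucket k s0 i) j
    else fun=> 0
  else V i j.
(* The tests without mask tell, uniformly on [D'], which recovered entries vanish. *)
pose rows' j := if j \in done then [seq i <- enum 'I_n | V' i j x0 != 0] else rows j.
apply: (IH k.+1 (J :\: done)%SET D' s' rows' V').
- lia.
- by move=> f /HP /mono.
- move=> i j; rewrite inE negb_and negbK /rows' /V'; case: ifPn => jd /=.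
    move: jd; rewrite inE => /andP[jJ /forallP /(_ i)/existsP[s1 Hs1]] _ _.
    case: pickP => [s0 _|/(_ s1)]; last by rewrite Hs1.
    by apply: hQ; exists s0, None, (bucket k s0 i), j.
  by move=> jJ /hV - /(_ jJ) /mono.
- move=> x Dx gx j; rewrite inE negb_and negbK /rows' /V'; case: ifPn => jd; last first.
    by move=> jJ; apply: okV => //; apply: DD'.
  move=> _; rewrite tnth_mktuple.
  have /andP[jJ /forallP Hd] : (j \in J) && [forall i, exists s0, passes k i j s0 x0].
    by move: (jd); rewrite inE.
  have VE i : exists s0, [/\ [pick s0 | passes k i j s0 x0] = Some s0
      & Z s0 None (bucket k s0 i) j x = M x i j].
    have /existsP[s1 Hs1] := Hd i.
    case: pickP => [s0 Hs0|/(_ s1)]; last by rewrite Hs1.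
    exists s0; split=> //; apply: Z_alone; apply: (gx k lek i j).1.
    by apply/passesP; rewrite sameP.
  rewrite (_ : [seq i <- enum 'I_n | _] = [seq i <- enum 'I_n | M x i j != 0]); last first.
    apply: eq_filter => i; rewrite ?jd; have [s0 [-> <-]] := VE i.
    by rewrite (sameZ _ _ _ _ x x0).
  by apply: eq_map => i; have [s0 [-> <-]] := VE i.
- move=> x Dx gx j; rewrite !inE /= => /andP[+ jJ]; rewrite jJ /= => /forallPn[i].
  rewrite negb_exists => /forallP ns; rewrite expnS.
  suff : ~~ (2 * col_nnz (M x) j <= 2 ^ k)%N by lia.
  apply/negP => /(gx k lek i j).2[s0 /(alone_looks_alone r)/passesP].
  by rewrite sameP // (negPf (ns s0)).
Qed.

Lemma solves_peeling s : (forall f, P0 f -> held s f) ->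
  solves (K.+1 * level_cost) setT s output.
Proof.
move=> HP; apply: (@solves_level K.+1 0 [set: 'I_n]%SET setT s (fun=> [::])
  (fun _ _ _ => 0)) => //.
by move=> x _ _ j; rewrite inE.
Qed.

End Peeling.

(** * Probability *)

Section Counting.

Lemma card_exists_le (I U : finType) (P : I -> pred U) :
  (#|[set u | [exists i, P i u]]| <= \sum_i #|[set u | P i u]|)%N.
Proof.
rewrite -sum1_card big_mkcond /=.
under [X in (_ <= X)%N]eq_bigr => i _ do rewrite -sum1_card big_mkcond /=.
rewrite exchange_big /=; apply: leq_sum => u _; rewrite inE.
case: existsP => // -[i Pi]; rewrite (bigD1 i) //= inE Pi; exact: leq_addr.
Qed.

(** Here and below, an inequality [#|E| * q <= #|U|] means that the event [E] has probability at
    most [1 / q]. In this case the bound is given conditionally on the first component. *)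
Lemma card_slices_le (U V : finType) (P : U -> V -> bool) (q : nat) :
  (forall u, #|[set v | P u v]| * q <= #|V|)%N ->
  (#|[set w : U * V | P w.1 w.2]| * q <= #|{: U * V}|)%N.
Proof.
move=> H; rewrite -sum1_card big_mkcond /=.
rewrite (eq_bigr (fun w => if P w.1 w.2 then 1 else 0)%N) => [|w _]; last by rewrite inE.
rewrite -(pair_bigA _ (fun u v => if P u v then 1 else 0)%N) /= big_distrl /=.
rewrite card_prod -sum_nat_const; apply: leq_sum => u _.
by apply: leq_trans (H u); rewrite -big_mkcond /= sum1dep_card.
Qed.

Lemma card_ffun_all (I U : finType) (P : pred U) :
  #|[set f : {ffun I -> U} | [forall i, P (f i)]]| = (#|[set u | P u]| ^ #|I|)%N.
Proof.
rewrite -card_ffun_on; apply: eq_card => f; rewrite inE.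
by apply/forallP/ffun_onP => H i; have := H i; rewrite inE.
Qed.

(** The values of a uniform [f] are independent, so the failure probabilities multiply. *)
Lemma card_ffun_all_le (I U : finType) (P : pred U) (q : nat) :
  (#|[set u | P u]| * q <= #|U|)%N ->
  (#|[set f : {ffun I -> U} | [forall i, P (f i)]]| * q ^ #|I| <= #|{: {ffun I -> U}}|)%N.
Proof.
by move=> H; rewrite card_ffun_all card_ffun -expnMn; case: #|I| => // m; rewrite leq_exp2r.
Qed.

End Counting.

(** * Random cuts and hash collisions *)

Section RandomEvents.
Variables (R : pzRingType) (n : nat).
Implicit Types (v : {ffun 'I_n -> bool}) (y : 'I_n -> R).

(* Flipping the bit of a row [i0 <> i] with [y i0 <> 0] changes the sum. *)
Lemma card_cut_sum0 (P : pred 'I_n) y (i i0 : 'I_n) :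
  i0 != i -> P i0 -> y i0 != 0 ->
  (#|[set v : {ffun 'I_n -> bool} | (\sum_(i' | P i' && (v i' != v i)) y i' == 0)%R]| * 2
     <= #|{: {ffun 'I_n -> bool}}|)%N.
Proof.
move=> ne Pi0 y0; set Q := [set v | _].
have ine : i != i0 by rewrite eq_sym.
pose flip v : {ffun 'I_n -> bool} := [ffun a => (a == i0) (+) v a].
have flipK : involutive flip.
  by move=> v; apply/ffunP => a; rewrite !ffunE addbA addbb.
have sumE v : v i0 != v i -> \sum_(i' | P i' && (v i' != v i)) y i' =
    y i0 + \sum_(i' | P i' && (flip v i' != flip v i)) y i'.
  move=> vi0; rewrite (bigD1 i0) /= ?Pi0 //; congr (_ + _).
  apply: eq_bigl => a; rewrite !ffunE (negPf ine) /=.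
  case: (eqVneq a i0) => [->|_] /=; rewrite ?andbF ?andbT //.
  by move: vi0; case: (v i0); case: (v i); rewrite ?andbF.
have dis : [disjoint Q & flip @: Q].
  rewrite finset.disjoints_subset; apply/fintype.subsetP => v vQ; rewrite inE.
  apply/negP => /imsetP[w wQ Ew]; move: vQ wQ.
  have -> : w = flip v by rewrite Ew flipK.
  rewrite !inE => /eqP H1 /eqP H2; case: (boolP (v i0 != v i)) => [/sumE|vi0].
    by rewrite H1 H2 addr0 => /esym/eqP; rewrite (negPf y0).
  have /sumE : flip v i0 != flip v i.
    rewrite !ffunE eqxx (negPf ine) /=.
    by move: vi0; case: (v i0); case: (v i).
  by rewrite flipK H1 H2 addr0 => /esym/eqP; rewrite (negPf y0).
rewrite muln2 -addnn -{2}(card_imset (mem Q) (inv_inj flipK)).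
by rewrite -cardsUI (_ : finset.setI Q (flip @: Q) = finset.set0) ?cards0 ?addn0 ?max_card //;
  apply/eqP; rewrite finset.setI_eq0.
Qed.

Variables (K k : nat).
Hypothesis lekK : (k <= K)%N.
Implicit Types g : {ffun 'I_n -> 'I_(2 ^ K)}.

(* Adding c < 2^k to the hash of i maps colliding functions injectively to all
   functions. *)
Lemma card_collision (i i' : 'I_n) : i' != i ->
  (#|[set g : {ffun 'I_n -> 'I_(2 ^ K)} | g i == g i' %[mod 2 ^ k]]| * 2 ^ k
     <= #|{: {ffun 'I_n -> 'I_(2 ^ K)}}|)%N.
Proof.
move=> ne; set C := [set g | _].
pose shift (gc : {ffun 'I_n -> 'I_(2 ^ K)} * 'I_(2 ^ k)) : {ffun 'I_n -> 'I_(2 ^ K)} :=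
  [ffun a => if a == i then Ordinal (ltn_pmod (gc.1 i + gc.2) (expn_gt0 2 K)) else gc.1 a].
(* Because of this divisibility, the wrap-around modulo [2 ^ K] does not disturb residues modulo
   [2 ^ k], from which the shift is recovered. *)
have dvd : (2 ^ k %| 2 ^ K)%N by rewrite dvdn_exp2l.
have inj : {in finset.setX C [set: 'I_(2 ^ k)]%SET &, injective shift}.
  move=> [g c] [g' c']; rewrite !inE !andbT /= => /eqP gC /eqP gC' E.
  have Ea a : a != i -> g a = g' a.
    by move=> ai; have := congr1 (fun f : {ffun _ -> _} => f a) E; rewrite !ffunE (negPf ai).
  have := congr1 (fun f : {ffun _ -> _} => val (f i)) E; rewrite !ffunE !eqxx /= => Ei.
  have cc : c = c'.
    apply: val_inj => /=; have := congr1 (modn^~ (2 ^ k)%N) Ei; rewrite /= !modn_dvdm //.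
    rewrite -modnDml gC (Ea _ ne) -gC' modnDml => /eqP; rewrite eqn_modDl.
    by rewrite !modn_small // => /eqP.
  congr pair => //; apply/ffunP => a; case: (eqVneq a i) => [->|/Ea//].
  apply: val_inj => /=; move/eqP: Ei; rewrite cc eqn_modDr !modn_small //.
  by move/eqP.
have -> : (2 ^ k = #|[set: 'I_(2 ^ k)]%SET|)%N by rewrite cardsT card_ord.
by rewrite -cardsX -(card_in_imset inj) max_card.
Qed.

(** Union bound over the [d] nonzero positions, each colliding with probability at most
    [1 / 2 ^ k]. *)
Lemma card_not_isolated y (i : 'I_n) :
  (2 * #|[set i | (y i != 0)%R]| <= 2 ^ k)%N ->
  (#|[set g : {ffun 'I_n -> 'I_(2 ^ K)} | [exists i' : 'I_n,
      [&& i' != i, g i == g i' %[mod 2 ^ k] & (y i' != 0)%R]]]| * 2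
     <= #|{: {ffun 'I_n -> 'I_(2 ^ K)}}|)%N.
Proof.
set d := #|_|; set G := #|{: {ffun _ -> _}}| => Hd; set E := #|_|.
have HE : (E * 2 ^ k <= d * G)%N.
  apply: leq_trans (_ : (\sum_(i' : 'I_n) if (y i' != 0)%R then G else 0) <= _)%N; last first.
    by rewrite -big_mkcond /= sum_nat_cond_const /d cardsE.
  apply: leq_trans (leq_mul (card_exists_le _) (leqnn _)) _.
  rewrite big_distrl /=; apply: leq_sum => i' _.
  case: (boolP (y i' != 0)) => _; last first.
    by rewrite [X in (X * _)%N]eq_card0 ?mul0n // => g; rewrite !inE !andbF.
  case: (eqVneq i' i) => [_|ne].
    by rewrite [X in (X * _)%N]eq_card0 ?mul0n // => g; rewrite !inE.
  apply: leq_trans (card_collision ne); rewrite leq_mul2r; apply/orP; right.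
  by apply/subset_leq_card/fintype.subsetP => g; rewrite !inE andbT.
have k0 : (0 < 2 ^ k)%N by rewrite expn_gt0.
rewrite -(leq_pmul2r k0) mulnAC; nia.
Qed.

End RandomEvents.

(** * The probability of a good seed *)

Section GoodRandomness.
Variables (R : pzRingType) (n rho K : nat) (M : 'M[R]_n).

(** Hash values range below a power of 2, so the number of seeds is a power of 2 and a string of
    random bits encodes a uniform seed. *)
Definition randomness : finType :=
  ({ffun 'I_rho -> {ffun 'I_n -> 'I_(2 ^ K)}} *
   {ffun 'I_rho -> {ffun 'I_n -> bool}})%type.

Definition good_seed (w : randomness) : Prop :=
  good_randomness K (fun s i => val (w.1 s i)) (fun t i => w.2 t i) M.

Lemma card_randomness : #|randomness| = (2 ^ (K * n * rho + n * rho))%N.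
Proof.
by rewrite card_prod !card_ffun card_bool !card_ord expnD !expnM.
Qed.

Let aloneb (k : nat) (g : {ffun 'I_n -> 'I_(2 ^ K)}) i j :=
  ~~ [exists i', [&& i' != i, g i == g i' %[mod 2 ^ k] & M i' j != 0]].

Let alonebP k (hs : {ffun 'I_rho -> {ffun 'I_n -> 'I_(2 ^ K)}}) s i j :
  reflect (alone (fun s i => val (hs s i)) M k s i j) (aloneb k (hs s) i j).
Proof.
apply: (iffP idP) => [/existsPn H i' ne sb|H].
  apply/eqP; rewrite -[_ == _]negbK; apply/negP => Mi'.
  by have := H i'; rewrite ne Mi' andbT /= (sb : is_true (_ == _ %[mod _])).
by apply/existsPn => i'; apply/negP => /and3P[ne sb /eqP[]]; apply: H.
Qed.

(** For [Some s], row [i] is not alone under the hash [s] and yet no cut reveals it; for [None],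
    column [j] is sparse but no hash isolates row [i]. This makes [rho.+1] events per [k], [i] and
    [j]. *)
Let bad (e : 'I_K.+1 * ('I_n * 'I_n) * option 'I_rho) (w : randomness) : bool :=
  let: (k, (i, j), os) := e in
  if os is Some s then
    ~~ aloneb k (w.1 s) i j && [forall t, \sum_(i' |
      (w.1 s i == w.1 s i' %[mod 2 ^ k]) && (w.2 t i' != w.2 t i)) M i' j == 0]
  else (2 * col_nnz M j <= 2 ^ k)%N && [forall s, ~~ aloneb k (w.1 s) i j].

(** For [Some s] the hash functions are fixed and [rho] independent cuts must all fail; for [None],
    [rho] independent hash functions must. *)
Lemma card_bad e : (#|[set w | bad e w]| * 2 ^ rho <= #|randomness|)%N.
Proof.
case: e => [[k [i j]] [s|]] /=.
  apply: (@card_slices_le _ _ (fun (hs : {ffun 'I_rho -> {ffun 'I_n -> 'I_(2 ^ K)}})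
      (rs : {ffun 'I_rho -> {ffun 'I_n -> bool}}) =>
    ~~ aloneb k (hs s) i j && [forall t, \sum_(i' |
      (hs s i == hs s i' %[mod 2 ^ k]) && (rs t i' != rs t i)) M i' j == 0])) => hs.
  case: (boolP (aloneb k (hs s) i j)) => /=.
    by move=> _; rewrite eq_card0 // => w; rewrite !inE.
  move=> /negPn/existsP[i0 /and3P[ne sb y0]].
  have := @card_ffun_all_le 'I_rho _ _ 2
   (@card_cut_sum0 R n (fun i' => hs s i == hs s i' %[mod 2 ^ k]) (M^~ j) i i0 ne sb y0).
  by rewrite card_ord.
have leK : (k <= K)%N by rewrite -ltnS.
case: (leqP (2 * col_nnz M j) (2 ^ k)) => /= [Hd|_]; last first.
  by rewrite eq_card0 // => w; rewrite !inE.
have := @card_ffun_all_le 'I_rho _ (fun g => ~~ aloneb k g i j) 2.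
rewrite card_ord => H.
have -> : [set w : randomness | [forall s, ~~ aloneb k (w.1 s) i j]] =
   finset.setX [set hs : {ffun 'I_rho -> {ffun 'I_n -> 'I_(2 ^ K)}} |
      [forall s, ~~ aloneb k (hs s) i j]] [set: _]%SET.
  by apply/finset.setP => w; rewrite !inE andbT.
rewrite cardsX cardsT mulnAC card_prod leq_mul2r H ?orbT //.
have := @card_not_isolated R n K k leK (M^~ j) i Hd.
by congr (_ * _ <= _)%N; apply: eq_card => g; rewrite !inE negbK.
Qed.

Lemma good_seed_not_bad w : ~~ [exists e, bad e w] -> good_seed w.
Proof.
move=> /existsPn H k lek i j; have ltk : (k < K.+1)%N by [].
split=> [s la|Hd].
  have /= := H (Ordinal ltk, (i, j), Some s); rewrite negb_and negbK.
  case/orP => [/alonebP//|/forallPn[t /eqP[]]]; exact: la.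
have /= := H (Ordinal ltk, (i, j), None); rewrite Hd /= => /forallPn[s].
by rewrite negbK => /alonebP Hs; exists s.
Qed.

Lemma good_seeds : (3 * (K.+1 * (n * n) * rho.+1) <= 2 ^ rho)%N ->
  exists2 W : {set randomness}, (forall w, w \in W -> good_seed w)
    & (2 * #|randomness| <= 3 * #|W|)%N.
Proof.
move=> Hrho; exists [set w | ~~ [exists e, bad e w]].
  by move=> w; rewrite inE; apply: good_seed_not_bad.
set b := #|_|; set G := #|randomness|.
set nb := #|[set w : randomness | [exists e, bad e w]]|.
have Ecard : (b + nb = G)%N.
  rewrite /b /nb /G -(finset.cardsC [set w | [exists e, bad e w]]) addnC; congr (_ + _)%N.
  by apply: eq_card => w; rewrite !inE.
have Hnb : (nb * 2 ^ rho <= K.+1 * (n * n) * rho.+1 * G)%N.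
  apply: leq_trans (leq_mul (card_exists_le _) (leqnn _)) _.
  rewrite big_distrl /=.
  have -> : (K.+1 * (n * n) * rho.+1 * G =
      \sum_(e : 'I_K.+1 * ('I_n * 'I_n) * option 'I_rho) G)%N.
    by rewrite sum_nat_const !card_prod card_option !card_ord.
  by apply: leq_sum => e _; apply: card_bad.
have r0 : (0 < 2 ^ rho)%N by rewrite expn_gt0.
suff : (3 * nb <= G)%N by lia.
rewrite -(leq_pmul2r r0) -mulnA; apply: leq_trans (leq_mul (leqnn 3) Hnb) _.
by rewrite mulnA [leqRHS]mulnC leq_mul2r Hrho orbT.
Qed.

End GoodRandomness.

(** As [K.+1] and [2 * n] are at most [2 ^ K], the left side, which is 12 times the square of
    [n * K.+1], is at most [3 * 2 ^ (4 * K)]. The summand 3 in [4 * K + 3] absorbs the factor 3 and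
    makes its successor [4 * K.+1]. *)
Lemma rounds_suffice n K : (2 * n <= 2 ^ K)%N ->
  (3 * (K.+1 * (n * n) * (4 * K + 3).+1) <= 2 ^ (4 * K + 3))%N.
Proof.
move=> HK; have HK1 : (K.+1 <= 2 ^ K)%N by apply: ltn_expl.
have -> : (2 ^ (4 * K + 3) = 2 ^ K * 2 ^ K * (2 ^ K * 2 ^ K) * 8)%N.
  by rewrite expnD (_ : 4 * K = K + K + (K + K))%N ?expnD //; lia.
have Hn : (4 * (n * n) <= 2 ^ K * 2 ^ K)%N.
  by rewrite (_ : 4 * (n * n) = (2 * n) * (2 * n))%N ?leq_mul //; lia.
have -> : ((4 * K + 3).+1 = 4 * K.+1)%N by lia.
have := leq_mul HK1 HK1; move: (2 ^ K * 2 ^ K)%N Hn => q Hn Hk.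
have := leq_mul Hn Hk; lia.
Qed.

(** * The algorithm *)

Section HeldLists.
Variables (R : pzRingType) (X : Type).
Implicit Types (s : seq (X -> R)) (f : X -> R).

Lemma held_catr s s' f : held s' f -> held (s ++ s') f.
Proof.
case=> i lti Hi; exists (size s + i)%N; first by rewrite size_cat ltn_add2l.
by move=> x; rewrite /regs map_cat nth_cat size_map ltnNge leq_addr addKn /= Hi.
Qed.

Lemma held_map (I : eqType) (r : seq I) (F : I -> X -> R) i :
  i \in r -> held [seq F i | i <- r] (F i).
Proof.
move=> ir; apply: held_mem; exists (index i r); rewrite size_map index_mem ir.
by rewrite (nth_map i) ?index_mem // nth_index.
Qed.

Lemma held_flatten (I : eqType) (r : seq I) (g : I -> seq (X -> R)) i f :
  i \in r -> held (g i) f -> held (flatten [seq g i | i <- r]) f.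
Proof.
elim: r => // j r IH; rewrite inE => /predU1P[->|ir] Hf; first exact: held_cat.
by apply: held_catr; apply: IH.
Qed.

End HeldLists.

Section PeelingTree.
Variables (R : pzRingType) (n : nat).

Lemma sparse_indicesE (A : 'M[R]_n) u : sparse_indices (sparse_repr A) = u ->
  forall j, tnth u j = [seq i <- enum 'I_n | A i j != 0].
Proof.
move=> <- j; rewrite tnth_map tnth_mktuple -map_comp.
by rewrite -[RHS]map_id; apply: eq_map.
Qed.

Lemma sparse_valuesE (A : 'M[R]_n) u : sparse_indices (sparse_repr A) = u ->
  sparse_values (sparse_repr A) =
  flatten [seq [seq A i j | i <- tnth u j] | j <- enum 'I_n].
Proof.
move=> Hu; rewrite /sparse_values /= -map_comp; congr flatten.
apply: eq_map => j /=; rewrite (sparse_indicesE Hu) -map_comp.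
exact: eq_map.
Qed.

(** The seed and the index lists are fixed, hence so are the supports: the inputs in [X] differ only
    in the values at these positions. *)
Lemma peeling_tree (rho K N F a : nat) (w : randomness n rho K)
    (u v : n.-tuple (seq 'I_n)) :
  (2 * n <= 2 ^ K)%N -> (2 ^ K <= 4 * n)%N ->
  (forall b c, (b <= 4 * n)%N -> (c <= n)%N -> (b = 1 \/ b * c <= 4 * N)%N ->
    forall (S : {set 'I_b * 'I_n}) (T : {set 'I_n * 'I_c}),
    (#|S| <= a)%N -> (#|T| <= a)%N -> mm_within R F S T) ->
  exists t : ctree R (sparse nat n n), forall A B : 'M[R]_n,
    sparse_indices (sparse_repr A) = u -> sparse_indices (sparse_repr B) = v ->
    (nnz A <= a)%N -> (nnz B <= a)%N -> (nnz (A *m B) <= N)%N ->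
    (cost_ctree t (input_registers A B)
       <= K.+1 * (rho * (1 + rho * 2) * (a + F + n + 4 * N)))%N /\
    (good_seed (A *m B) w ->
       tree_output t (input_registers A B) = sparse_repr (A *m B)).
Proof.
move=> K_ge K_le HF.
pose ok (x : 'M[R]_n * 'M[R]_n) :=
  [/\ sparse_indices (sparse_repr x.1) = u, sparse_indices (sparse_repr x.2) = v,
      (nnz x.1 <= a)%N, (nnz x.2 <= a)%N & (nnz (x.1 *m x.2) <= N)%N].
(* If no admissible input has these index lists, any tree will do. Otherwise [x0] provides the
   bounds on the sizes of the supports. *)
have [[x0 ok0]|none] := pselect (exists x, ok x); last first.
  exists (Leaf R [tuple [::] | j < n]) => A B Hu Hv HA HB HAB.
  by case: none; exists (A, B).
pose X := {x : 'M[R]_n * 'M[R]_n | ok x}.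
pose A (x : X) := (sval x).1; pose B (x : X) := (sval x).2.
pose supp (u : n.-tuple (seq 'I_n)) := [set e : 'I_n * 'I_n | e.1 \in tnth u e.2].
have suppE (C : 'M[R]_n) u' : sparse_indices (sparse_repr C) = u' ->
    supp u' = [set e | C e.1 e.2 != 0].
  move=> Hu; apply/finset.setP => e; rewrite !inE (sparse_indicesE Hu).
  by rewrite mem_filter mem_enum andbT.
have suppP (C : 'M[R]_n) u' : sparse_indices (sparse_repr C) = u' -> supported (supp u') C.
  by move=> /suppE -> i j; rewrite inE negbK => /eqP.
have suppA (x : X) : supported (supp u) (A x) by apply: suppP; case: (svalP x).
have suppB (x : X) : supported (supp v) (B x) by apply: suppP; case: (svalP x).
have HN (x : X) : (nnz (A x *m B x) <= N)%N by case: (svalP x).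
have [Hu0 Hv0 HA0 HB0 _] := ok0.
have cu : (#|supp u| <= a)%N by rewrite (suppE _ _ Hu0).
have cv : (#|supp v| <= a)%N by rewrite (suppE _ _ Hv0).
pose s : seq (X -> R) :=
  flatten [seq [seq (fun x => A x i j) | i <- tnth u j] | j <- enum 'I_n] ++
  flatten [seq [seq (fun x => B x i j) | i <- tnth v j] | j <- enum 'I_n].
have regsE (x : X) : regs s x = input_registers (A x) (B x).
  case: (svalP x) => Hu Hv _ _ _; rewrite /input_registers.
  rewrite (sparse_valuesE Hu) (sparse_valuesE Hv) /regs map_cat !map_flatten -!map_comp.
  by congr (flatten _ ++ flatten _); apply: eq_map => j /=; rewrite -map_comp.
have [||t Ht] := @solves_peeling R n rho K N F X (fun s i => val (w.1 s i))
  (fun t i => w.2 t i) A B (supp u) (supp v) suppA suppB HN K_ge K_le _ s.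
- move=> b c hb hc hbc S T hS hT.
  by apply: HF => //; [apply: leq_trans hS cu|apply: leq_trans hT cv].
- move=> f [] [[i j]]; rewrite inE /= => ij ->; [apply: held_cat|apply: held_catr];
    apply: (@held_flatten _ _ _ _ _ j); rewrite ?mem_enum //.
  + exact: (held_map (fun i x => A x i j)).
  + exact: (held_map (fun i x => B x i j)).
exists t => A1 B1 Hu Hv HA1 HB1 HN1.
have ok1 : ok (A1, B1) by [].
have [] := Ht (exist _ (A1, B1) ok1 : X) I; rewrite regsE /= => ct gt; split=> //.
apply: leq_trans ct _; rewrite /level_cost leq_mul2l /= leq_mul2l.
by rewrite !leq_add2r cu orbT.
Qed.

End PeelingTree.

Section RandomizedAlgorithm.
Variable R : pzRingType.

Definition seed_of_tape n rho K (L : nat) (e : #|{: L.-tuple bool}| = #|randomness n rho K|)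
    (tape : L.-tuple bool) : randomness n rho K :=
  enum_val (cast_ord e (enum_rank tape)).

Lemma seed_of_tape_bij n rho K L e : bijective (@seed_of_tape n rho K L e).
Proof.
exists (fun w => enum_val (cast_ord (esym e) (enum_rank w))) => x.
  by rewrite /seed_of_tape enum_valK cast_ordK enum_rankK.
by rewrite /seed_of_tape enum_valK cast_ordKV enum_rankK.
Qed.

Lemma peeling_algorithm (Kr : realType) (n K N F a : nat) :
  (2 * n <= 2 ^ K)%N -> (2 ^ K <= 4 * n)%N ->
  (forall b c, (b <= 4 * n)%N -> (c <= n)%N -> (b = 1 \/ b * c <= 4 * N)%N ->
    forall (S : {set 'I_b * 'I_n}) (T : {set 'I_n * 'I_c}),
    (#|S| <= a)%N -> (#|T| <= a)%N -> mm_within R F S T) ->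
  exists P : rand_mm_alg R n, forall A B : 'M[R]_n,
    (nnz A <= a)%N -> (nnz B <= a)%N -> (nnz (A *m B) <= N)%N ->
    (forall tape : (tape_len P).-tuple bool, (alg_cost A B tape
       <= K.+1 * ((4 * K + 3) * (1 + (4 * K + 3) * 2) * (a + F + n + 4 * N)))%N) /\
    2%:R / 3%:R <= success_prob Kr P A B.
Proof.
move=> K_ge K_le HF; set rho := (4 * K + 3)%N.
pose L := (K * n * rho + n * rho)%N.
have e : #|{: L.-tuple bool}| = #|randomness n rho K|.
  by rewrite card_tuple card_bool card_randomness.
have /choice[tr Htr] := fun z : L.-tuple bool * n.-tuple (seq 'I_n) * n.-tuple (seq 'I_n) =>
  @peeling_tree R n rho K N F a (seed_of_tape e z.1.1) z.1.2 z.2 K_ge K_le HF.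
exists (@RandMMAlg R n L (fun tape u v => tr (tape, u, v))) => A B HA HB HAB.
split=> [tape|].
  exact: (Htr (tape, _, _) A B erefl erefl HA HB HAB).1.
have [W HW cW] := good_seeds (A *m B) (rounds_suffice K_ge).
rewrite /success_prob /=.
set G := [set _ | _].
have cG : (#|W| <= #|G|)%N.
  have [g gK Kg] := seed_of_tape_bij e.
  rewrite -(card_imset (mem W) (can_inj Kg)); apply/subset_leq_card/fintype.subsetP.
  move=> _ /imsetP[w wW ->]; rewrite inE.
  have [_ /(_ _) out] := Htr (g w, _, _) A B erefl erefl HA HB HAB.
  apply/forallP => j; rewrite /alg_output -/(tree_output _ _) out ?perm_refl //.
  by rewrite /= Kg; apply: HW.
have G0 : (0 : Kr) < #|{: L.-tuple bool}|%:R.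
  by rewrite ltr0n card_tuple card_bool expn_gt0.
rewrite ler_pdivlMr // mulrAC ler_pdivrMr ?ltr0n // -!natrM ler_nat e.
by apply: leq_trans cW _; rewrite mulnC leq_mul2r cG orbT.
Qed.

(** Over the zero ring the sparse output is empty. This case is set apart because the proof of
    [beta >= dout] rests on [1 != 0]. *)
Lemma FSMM_solvable_trivial (K : realType) din dout (f : nat -> K) :
  (1 : R) = 0 -> (forall n, 0 <= f n) -> FSMM_solvable R din dout f.
Proof.
move=> R1 f0 C.
have R0 (x : R) : x = 0 by rewrite -[x]mul1r R1 mul0r.
exists (fun n => @RandMMAlg R n 0 (fun _ _ _ => Leaf R [tuple [::] | j < n])), 0.
move=> n n0 A B _ _ _; split=> [tape|]; first by rewrite mul0r.
rewrite /success_prob (_ : [set _ | _] = [set: 0.-tuple bool]%SET).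
  rewrite cardsT card_tuple expn0 divr1 ler_pdivrMr ?ltr0n // mul1r ler_nat //.
apply/finset.setP => tape; rewrite !inE; apply/forallP => j.
rewrite /alg_output /= tnth_map !tnth_mktuple.
rewrite (_ : [seq i <- enum 'I_n | _] = [::]) //.
apply/eqP; rewrite -[_ == _]negbK -has_filter; apply/hasPn => i _.
by rewrite negbK (R0 (_ i j)).
Qed.

End RandomizedAlgorithm.

(** The exponent is the last level: the lower bound lets it isolate rows even in full columns, the
    upper one keeps the number of buckets linear in [n]. *)
Lemma up_logS_bounds n : (0 < n)%N ->
  (2 * n <= 2 ^ (up_log 2 n).+1)%N /\ (2 ^ (up_log 2 n).+1 <= 4 * n)%N.
Proof.
move=> n0; rewrite expnS leq_mul2l up_logP //; split=> //.
rewrite -[4%N]/(2 * 2)%N -mulnA leq_mul2l /=.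
have [n1|n1] := leqP n 1.
  have -> : n = 1%N by apply/eqP; rewrite eqn_leq n1.
  by rewrite up_log1.
have /andP[Hlt _] := up_log_bounds (isT : (1 < 2)%N) n1.
have Hk : (0 < up_log 2 n)%N by rewrite up_log_gt0 n1.
by rewrite -[up_log 2 n]prednK // expnS leq_mul2l ltnW.
Qed.

(** * Asymptotic cost *)

Section Asymptotics.
Variables (K : realType) (R : pzRingType).
Implicit Types (din dout beta eps C : K).

(** The numbers of levels, of hash functions and of masks are each linear in the logarithm of [n],
    and each gets a share [eps / 3]. *)
Lemma polylog_natpow eps : 0 < eps -> exists E : K, forall n, (0 < n)%N ->
  let k := (up_log 2 n).+1 in
  (k.+1 * ((4 * k + 3) * (1 + (4 * k + 3) * 2)))%:R <= E * n%:R `^ eps.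
Proof.
move=> eps0; have e30 : 0 < eps / 3 by rewrite divr_gt0.
have [E HE] := up_log_natpow e30.
exists ((`|E| + 2) * ((4 * `|E| + 7) * (8 * `|E| + 15))) => n n0 /=.
set l := up_log 2 n; set y : K := n%:R `^ (eps / 3).
have y1 : 1 <= y by apply: natpow_ge1 => //; apply: ltW.
have ly : l%:R <= `|E| * y.
  by apply: le_trans (HE n n0) _; rewrite ler_wpM2r ?ler_norm //; lra.
have -> : n%:R `^ eps = y * (y * y).
  by rewrite /y -!natpowD //; congr (_ `^ _); lra.
have E0 : 0 <= `|E| by [].
have -> : (l.+2 * ((4 * l.+1 + 3) * (1 + (4 * l.+1 + 3) * 2)) =
    (l + 2) * ((4 * l + 7) * (8 * l + 15)))%N.
  by congr (_ * (_ * _))%N; lia.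
rewrite !natrM !natrD.
rewrite (_ : _ * (y * (y * y)) =
  ((`|E| + 2) * y) * (((4 * `|E| + 7) * y) * ((8 * `|E| + 15) * y))); last by ring.
have l0 : 0 <= l%:R :> K by [].
by rewrite ler_pM ?mulr_ge0 ?addr_ge0 ?mulr_ge0 //;
  [lra|rewrite ler_pM ?addr_ge0 ?mulr_ge0 //; lra].
Qed.

(** One half of [eps] is the slack in the exponent of the products, the other absorbs the
    polylogarithmic overhead. *)
Lemma FSMM_solvable_rect din dout beta eps :
  1 <= din -> dout <= beta -> 0 < eps ->
  mm_exponent R din (beta + eps / 2) (fun C n a c =>
    [/\ a%:R <= C * n%:R, c%:R <= C * n%:R & (a * c)%:R <= C * n%:R `^ dout]) ->
  FSMM_solvable R din dout
    (fun n : nat => n%:R `^ (din + eps) + n%:R `^ (beta + eps)).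
Proof.
move=> din1 dob eps0 rect C.
have eps20 : 0 < eps / 2 by rewrite divr_gt0.
(* The outer dimensions are at most [4 * n] and their product is at most [4 * N], hence at most
   [4 * |C| * n ^ dout]. *)
have [D HD] := rect (4 * `|C| + 4); have [E HE] := polylog_natpow eps20.
have C0 : 0 <= `|C| by []. have D0 : 0 <= `|D| by [].
suff H n : exists P : rand_mm_alg R n, (0 < n)%N -> forall A B : 'M[R]_n,
    (nnz A)%:R <= C * n%:R `^ din -> (nnz B)%:R <= C * n%:R `^ din ->
    (nnz (A *m B))%:R <= C * n%:R `^ dout ->
    (forall tape : (tape_len P).-tuple bool, (alg_cost A B tape)%:R <=
      (`|E| * (7 * `|C| + 1 + `|D|)) * (n%:R `^ (din + eps) + n%:R `^ (beta + eps))) /\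
    2%:R / 3%:R <= success_prob K P A B.
  exists (fun n => sval (cid (H n))), (`|E| * (7 * `|C| + 1 + `|D|)).
  by move=> n n0 A B; apply: (svalP (cid (H n)) n0).
case: (posnP n) => [n0|n0].
  by exists (@RandMMAlg R n 0 (fun _ _ _ => Leaf R [tuple [::] | j < n])); rewrite n0.
set xin : K := n%:R `^ din; set xout : K := n%:R `^ dout.
set xb : K := n%:R `^ (beta + eps / 2).
have xin0 : 0 <= xin by apply: natpow_ge0.
have xout0 : 0 <= xout by apply: natpow_ge0.
have xb0 : 0 <= xb by apply: natpow_ge0.
have n_xin : n%:R <= xin by rewrite /xin -[leLHS]powRr1 // natpow_le.
have xout_xb : xout <= xb by rewrite natpow_le //; lra.
pose a := Num.truncn (`|C| * xin); pose N := Num.truncn (`|C| * xout).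
(* The second summand pays for the naive product with a single row at level 0. *)
pose F := Num.truncn (`|D| * xb + 2 * (`|C| * xin)).
have a_le : a%:R <= `|C| * xin by rewrite truncn_le mulr_ge0.
have N_le : N%:R <= `|C| * xout by rewrite truncn_le mulr_ge0.
have F0 : 0 <= `|D| * xb + 2 * (`|C| * xin) by rewrite addr_ge0 ?mulr_ge0.
have F_le : F%:R <= `|D| * xb + 2 * (`|C| * xin) by rewrite truncn_le.
pose k := (up_log 2 n).+1.
have [k_ge k_le] := up_logS_bounds n0.
have le_a m : m%:R <= C * xin -> (m <= a)%N.
  move=> Hm; rewrite truncn_ge_nat ?mulr_ge0 //; apply: le_trans Hm _.
  by rewrite ler_wpM2r // ler_norm.
have HF b c : (b <= 4 * n)%N -> (c <= n)%N -> (b = 1 \/ b * c <= 4 * N)%N ->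
    forall (S : {set 'I_b * 'I_n}) (T : {set 'I_n * 'I_c}),
    (#|S| <= a)%N -> (#|T| <= a)%N -> mm_within R F S T.
  move=> hb hc hbc S T hS hT; rewrite -!(ler_nat K) in hb hc hS hT.
  rewrite natrM in hb.
  have nn : 0 <= n%:R :> K by [].
  have CN : 0 <= `|C| * n%:R by rewrite mulr_ge0.
  have CX : 0 <= `|C| * xin by rewrite mulr_ge0.
  have CO : 0 <= `|C| * xout by rewrite mulr_ge0.
  case: hbc => [b1|hbc].
    apply: mm_within_leq (@mm_within_naive R b n c S T).
    rewrite truncn_ge_nat // b1 mul1n natrM.
    have : 0 <= `|D| * xb by rewrite mulr_ge0.
    by lra.
  rewrite -(ler_nat K) natrM [(4 * N)%:R]natrM in hbc.
  have [|||G HG HW] := HD n b c n0 _ S T.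
  - by split; rewrite ?natrM -/xout; lra.
  - by rewrite -/xin; lra.
  - by rewrite -/xin; lra.
  apply: mm_within_leq HW; rewrite truncn_ge_nat //.
  apply: le_trans HG _; rewrite -/xb.
  have : D * xb <= `|D| * xb by rewrite ler_wpM2r // ler_norm.
  by lra.
have [P HP] := peeling_algorithm K k_ge k_le HF.
exists P => _ A B HA HB HAB.
have [|||cost_P succ_P] := HP A B.
- exact: le_a.
- exact: le_a.
- rewrite truncn_ge_nat ?mulr_ge0 //; apply: le_trans HAB _.
  by rewrite ler_wpM2r // ler_norm.
split=> // tape; have := cost_P tape; rewrite -(ler_nat K) => Hc.
apply: le_trans Hc _; rewrite mulnA natrM.
have Hlog := HE n n0; rewrite /= -/k in Hlog.
set q := (k.+1 * _)%N in Hlog *.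
(* Here 7 = 1 + 2 + 4 collects the shares of [a], of the naive part of [F] and of [4 * N]; the
   summand 1 is the share of [n]. *)
have Hsum : (a + F + n + 4 * N)%:R <= (7 * `|C| + 1 + `|D|) * (xin + xb).
  rewrite !natrD.
  have h1 : `|C| * xout <= `|C| * xb by rewrite ler_wpM2l.
  have h2 : 0 <= `|C| * xin by rewrite mulr_ge0.
  have h3 : 0 <= `|D| * xin by rewrite mulr_ge0.
  have h4 : 0 <= `|C| * xb by rewrite mulr_ge0.
  by rewrite !mulrDl !mulrDr; lra.
set y : K := n%:R `^ (eps / 2) in Hlog.
have y0 : 0 <= y by apply: natpow_ge0.
have Hq : q%:R <= `|E| * y by apply: le_trans Hlog _; rewrite ler_wpM2r // ler_norm.
have Hy : (xin + xb) * y <= n%:R `^ (din + eps) + n%:R `^ (beta + eps).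
  rewrite mulrDl -!natpowD //; apply: lerD; apply: natpow_le => //; lra.
apply: le_trans (_ : (`|E| * y) * ((7 * `|C| + 1 + `|D|) * (xin + xb)) <= _).
  by rewrite ler_pM.
rewrite (_ : _ * _ = (`|E| * (7 * `|C| + 1 + `|D|)) * ((xin + xb) * y)); last by ring.
by rewrite ler_wpM2l // mulr_ge0 ?addr_ge0 ?mulr_ge0.
Qed.

End Asymptotics.

Theorem theorem4p2 (K : realType) (R : pzRingType) (din dout eps : K)
    (hdin : 1 <= din <= 2%:R)
    (hdout : 0 <= dout <= 2%:R * din)
    (hdout2 : dout <= 2%:R)
    (heps : 0 < eps) :
  exists beta : K,
    is_max (omega_values R din dout) beta /\
    FSMM_solvable R din dout
      (fun n : nat => n%:R `^ (din + eps) + n%:R `^ (beta + eps)).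
Proof.
have /andP[din1 _] := hdin; have /andP[dout0 _] := hdout.
have doutP : 0 <= dout <= 2 by apply/andP.
have [beta beta_max] := omega_values_max R din1 doutP.
exists beta; split=> //; have [R1|R1] := eqVneq (1 : R) 0.
  by apply: FSMM_solvable_trivial => // n; rewrite addr_ge0 ?natpow_ge0.
have [[e1 [e2 [e1P e2P De beta_eq]]] beta_ub] := beta_max.
apply: FSMM_solvable_rect => //; first by rewrite -De beta_eq omega_ge.
by apply: mm_exponent_rect => //; rewrite divr_gt0.
Qed.
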